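(* Let $N$ be the unipotent radical of a parabolic subgroup of a real reductive Lie group $G$, let $\mathfrak n=\mathrm{Lie}(N)$, and let $\pi$ be in $\mathrm{Rep}^{\infty,F}(N)$. Put $\mathbf{CJ}_s^{\infty}(\pi)=\bigcap_{k\ge0}\overline{\mathfrak n^k.\pi}$. Then there exists a countable family $\{q_j\}$ of seminorms defining the topology of $\pi/\mathbf{CJ}_s^{\infty}(\pi)$ such that for each $q_j$ there exists a sufficiently large integer $k_j>0$ such that $q_j$ vanishes on $\overline{\mathfrak n^k.\pi}/\mathbf{CJ}_s^{\infty}(\pi)$ for all $k>k_j$. In particular, for any $r>k>k_j$, the seminorm $\widetilde q_j$ induced by $q_j$ on $\overline{\mathfrak n^k.\pi}/\overline{\mathfrak n^r.\pi}$ vanishes.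
   Context: Fix an algebraic scale $\|\cdot\|_G$ on $G$, e.g. $\|g\|_G=\mathrm{tr}(\rho(g)\rho(g)^* )+\mathrm{tr}(\rho(g^{-1})\rho(g^{-1})^* )$ for a finite-dimensional representation $\rho$ with finite kernel and closed image. $\mathrm{Rep}^{\infty,F}(N)$ is the category of smooth Fréchet representations of $N$ of moderate growth: complex Fréchet spaces $\pi$ with a continuous linear $N$-action with smooth orbit maps such that for every continuous seminorm $p_1$ there are $r\ge0$ and a continuous seminorm $p_2$ with $p_1(g.v)\le\|g\|_G^rp_2(v)$ for all $g\in N$, $v\in\pi$. $\mathfrak n^k.\pi$ is the span of all $X_1\cdots X_k.v$ with $X_i\in\mathfrak n$, $v\in\pi$ ($\mathfrak n^0.\pi=\pi$); closures are in $\pi$. The induced seminorm of $q$ on a quotient is $\widetilde q([v])=\inf\{q(\widetilde v):\widetilde v\in[v]\}$. *)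

(* Defs.v *)
From HB Require Import structures.
From mathcomp Require Import all_boot all_order all_algebra.
From mathcomp Require Import all_classical all_reals topology.
From mathcomp Require Import normedtype tvs derive exp complex.
From mathcomp Require mpoly.
Import Order.TTheory GRing.Theory Num.Theory.
Import numFieldNormedType.Exports.

Set Implicit Arguments.
Unset Strict Implicit.
Unset Printing Implicit Defensive.

Local Open Scope classical_set_scope.
Local Open Scope ring_scope.
Local Open Scope quotient_scope.
Local Open Scope complex_scope.

Definition lspan (K : pzRingType) (V : lmodType K) (S : set V) : set V :=
  [set v | exists (m : nat) (c : 'I_m -> K) (x : 'I_m -> V),
     (forall i, S (x i)) /\ v = \sum_(i < m) c i *: x i].

Record submodule (K : pzRingType) (V : lmodType K) := Submodule {
  submodule_pred :> {pred V};
  submoduleP : submod_closed submodule_pred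
}.

HB.instance Definition _ (K : pzRingType) (V : lmodType K) (W : submodule V) :=
  GRing.isSubmodClosed.Build K V (submodule_pred W)
    (GRing.submod_closed_semi (submoduleP W)).

Fact lspan_submod (K : pzRingType) (V : lmodType K) (S : set V) :
  lspan S 0 /\ forall a x y, lspan S x -> lspan S y -> lspan S (a *: x + y).
Proof.
split; first by exists 0, (fun _ => 0), (fun _ => 0); split=> [[]|] //; rewrite big_ord0.
move=> a _ _ [m [c [x [Sx ->]]]] [p [d [y [Sy ->]]]].
exists (m + p)%N, (fun i => match fintype.split i with inl j => a * c j | inr j => d j end),
  (fun i => match fintype.split i with inl j => x j | inr j => y j end); split.
  by move=> i; case: (fintype.split i).
rewrite big_split_ord /= scaler_sumr; congr (_ + _); apply: eq_bigr => i _.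
  by rewrite (unsplitK (inl i)) scalerA.
by rewrite (unsplitK (inr i)).
Qed.

Definition span_closure (K : numFieldType) (V : topologicalLmodType K)
  (S : set V) : {pred V} := [pred v | v \in closure (lspan S)].

Fact span_closure_submod (K : numFieldType) (V : topologicalLmodType K)
  (S : set V) : submod_closed (span_closure S).
Proof.
have [S0 SP] := lspan_submod S; split.
  by apply/mem_set; exact: subset_closure.
move=> a x y /set_mem xS /set_mem yS; apply/mem_set => B nB.
have scont : continuous (fun z : V => a *: z).
  move=> z; apply: (@continuous_comp V (K^o * V)%type V (fun z => (a, z))
    (fun z => z.1 *: z.2)); last exact: scale_continuous.
  by apply: (@cvg_pair _ _ _ _ (nbhs (a : K^o))); [exact: cvg_cst|exact: cvg_id].
have := @add_continuous V (a *: x, y) B nB => -[[B1 B2] /= [nB1 nB2] sB].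
have [u [Su /= B1u]] := xS _ (scont x B1 nB1).
have [w [Sw B2w]] := yS _ nB2.
exists (a *: u + w); split; first exact: SP.
exact: (sB (a *: u, w)).
Qed.

Definition closed_span (K : numFieldType) (V : topologicalLmodType K)
  (S : set V) : submodule V := Submodule (span_closure_submod S).

Definition quot_tvs (K : numFieldType) (V : topologicalLmodType K)
  (W : submodule V) : Type := quotient_topology (Quotient.quot W).

Section QuotTvs.
Variables (K : numFieldType) (V : topologicalLmodType K) (W : submodule V).
Local Notation Q := (quot_tvs W).

HB.instance Definition _ := Topological.copy Q (quotient_topology (Quotient.quot W)).
HB.instance Definition _ := Quotient.copy Q (quotient_topology (Quotient.quot W)).
HB.instance Definition _ := GRing.isZmodule.Build Q (@Quotient.addqA _ W)
  (@Quotient.addqC _ W) (@Quotient.add0q _ W) (@Quotient.addNq _ W).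

Definition quot_pi : V -> Q := \pi_Q.

Lemma quot_piP x y : reflect (quot_pi x = quot_pi y) (x - y \in W).
Proof.
rewrite /quot_pi Quotient.idealrBE; apply: (iffP eqP) => //.
Qed.

Definition quot_scale (a : K) (x : Q) : Q := quot_pi (a *: repr x).

Lemma quot_scaleE a x : quot_scale a (quot_pi x) = quot_pi (a *: x).
Proof.
apply/quot_piP; rewrite -scalerBr; apply: rpredZ; apply/quot_piP.
exact: reprK.
Qed.

Lemma quot_piD x y : quot_pi (x + y) = quot_pi x + quot_pi y.
Proof. exact: Quotient.pi_add. Qed.

Lemma quot_pi_repr (x : Q) : quot_pi (repr x) = x.
Proof. exact: reprK. Qed.

Fact quot_scaleA a b (x : Q) :
  quot_scale a (quot_scale b x) = quot_scale (a * b) x.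
Proof. by rewrite -[x]quot_pi_repr !quot_scaleE scalerA. Qed.

Fact quot_scale1 : left_id 1 quot_scale.
Proof. by move=> x; rewrite -[x]quot_pi_repr quot_scaleE scale1r. Qed.

Fact quot_scaleDr : right_distributive quot_scale +%R.
Proof.
move=> a x y; rewrite -[x]quot_pi_repr -[y]quot_pi_repr.
by rewrite -quot_piD !quot_scaleE -quot_piD scalerDr.
Qed.

Fact quot_scaleDl (x : Q) : {morph quot_scale^~ x : a b / a + b}.
Proof.
by move=> a b; rewrite -[x]quot_pi_repr !quot_scaleE -quot_piD scalerDl.
Qed.

HB.instance Definition _ := GRing.Zmodule_isLmodule.Build K Q
  quot_scaleA quot_scale1 quot_scaleDr quot_scaleDl.
End QuotTvs.

Section ComplexTvs.
Variable R : realType.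

HB.instance Definition _ := PseudoPointedMetric.copy R[i] (R[i]^o).

Definition seminorm (V : lmodType R[i]) (p : V -> R) : Prop :=
  (forall v w, p (v + w) <= p v + p w) /\
  (forall (a : R[i]) v, p (a *: v) = complex.Re `|a| * p v).

Definition continuous_seminorm (V : preTopologicalLmodType R[i]) (p : V -> R) :
  Prop := seminorm p /\ continuous p.

Definition defines_topology (V : preTopologicalLmodType R[i])
    (q : nat -> V -> R) : Prop :=
  forall (x : V) (A : set V), nbhs x A <->
    exists (J : seq nat) (e : R), 0 < e /\
      [set y | forall j, j \in J -> q j (y - x) < e] `<=` A.

(* Completeness refers to the additive uniformity, which the uniform structure
   bundled in [tvsType] is not required to be. *)
Definition frechet (V : tvsType R[i]) : Prop :=
  [/\ hausdorff_space V,
      exists B : nat -> set V, (forall i, nbhs 0 (B i)) /\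
        forall U, nbhs 0 U -> exists i, B i `<=` U
    & forall F : set_system V, ProperFilter F ->
        (forall U, nbhs (0 : V) U ->
           exists2 A, F A & forall x y, A x -> A y -> U (x - y)) ->
        exists l : V, F --> l].

(* Seminorm on [V / B] induced by a seminorm on [V / A], for [A] inside [B]. *)
Definition induced_seminorm (V : topologicalLmodType R[i]) (A B : submodule V)
    (q : quot_tvs A -> R) (x : quot_tvs B) : R :=
  inf [set q (quot_pi A v) | v in [set v | quot_pi B v = x]].

End ComplexTvs.

HB.mixin Record isTopologicalGroup G & Group G & Topological G := {
  mulg_continuous : continuous (fun x : G * G => (x.1 * x.2)%g);
  invg_continuous : continuous (fun x : G => (x^-1)%g)
}.

#[short(type="topGroupType")]
HB.structure Definition TopologicalGroup :=
  {G of Group G & Topological G & isTopologicalGroup G}.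

Section Groups.
Variable R : realType.
Implicit Types G N : topGroupType.

Definition subgroup G (H : set G) : Prop :=
  [/\ H 1%g, forall x y, H x -> H y -> H (x * y)%g
    & forall x, H x -> H (x^-1)%g].

Definition one_param G (gamma : R -> G) : Prop :=
  continuous gamma /\ forall s t, gamma (s + t) = (gamma s * gamma t)%g.

Definition matrix_rep (K : pzRingType) G n (rho : G -> 'M[K]_n) : Prop :=
  rho 1%g = 1%:M /\ forall x y, rho (x * y)%g = rho x *m rho y.

Definition self_adjoint_algebraic_group n (S : set 'M[R]_n) : Prop :=
  [/\ exists F : set (mpoly.mpoly (n * n) R),
        S = [set A | A \in unitmx /\
               forall f, F f -> mpoly.meval (fun i => mxvec A 0 i) f = 0],
      S 1%:M,
      forall A B, S A -> S B -> S (A *m B),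
      forall A, S A -> S (invmx A)
    & forall A, S A -> S A^T].

(* [G] is real reductive in the sense of Wallach: a finite covering, via [rho],
   of an open subgroup of a self-adjoint real algebraic group [S]. The last
   clause says that [rho] is open as a map into [S]; it makes [rho] a covering
   onto its image and makes this image open in [S]. *)
Definition real_reductive G n (rho : G -> 'M[R]_n) : Prop :=
  [/\ hausdorff_space G,
      matrix_rep rho,
      continuous rho,
      finite_set [set g | rho g = 1%:M]
    & exists2 S, self_adjoint_algebraic_group S &
        forall U, open U -> exists2 V, open V & rho @` U = S `&` V].

Definition lie_bracket (K : pzRingType) n (X Y : 'M[K]_n) : 'M[K]_n :=
  X *m Y - Y *m X.

Definition lie_subalgebra (K : pzRingType) n (L : set 'M[K]_n) : Prop :=
  [/\ L 0, forall a X Y, L X -> L Y -> L (a *: X + Y)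
    & forall X Y, L X -> L Y -> L (lie_bracket X Y)].

Definition derived_algebra (K : pzRingType) n (L : set 'M[K]_n) : set 'M[K]_n :=
  lspan [set Z | exists X Y, [/\ L X, L Y & Z = lie_bracket X Y]].

Definition solvable_algebra (K : pzRingType) n (L : set 'M[K]_n) : Prop :=
  exists k, iter k (@derived_algebra K n) L `<=` [set 0].

Definition borel_subalgebra n (L b : set 'M[R[i]]_n) : Prop :=
  [/\ lie_subalgebra b, b `<=` L, solvable_algebra b
    & forall b', lie_subalgebra b' -> b' `<=` L -> solvable_algebra b' ->
        b `<=` b' -> b' = b].

Definition complexification n (L : set 'M[R]_n) : set 'M[R[i]]_n :=
  [set Z | exists X Y, [/\ L X, L Y &
     Z = \matrix_(i, j) (X i j +i* Y i j)]].

Definition parabolic_subalgebra n (L q : set 'M[R]_n) : Prop :=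
  [/\ lie_subalgebra q, q `<=` L
    & exists2 b, borel_subalgebra (complexification L) b
               & b `<=` complexification q].

(* The Lie algebra of [G], identified with its image under [d rho]. *)
Definition lie_algebra G n (rho : G -> 'M[R]_n) : set 'M[R]_n :=
  [set X | exists2 gamma, one_param gamma
         & is_derive (0 : R) (1 : R) (rho \o gamma) X].

(* Normalizers in [G] of the parabolic subalgebras. *)
Definition parabolic_subgroup G n (rho : G -> 'M[R]_n) (P : set G) : Prop :=
  exists2 q, parabolic_subalgebra (lie_algebra rho) q &
    P = [set g | [set rho g *m X *m rho (g^-1)%g | X in q] = q].

Definition unipotent n (A : 'M[R]_n) : Prop := exists k, (A - 1%:M) ^+ k = 0.

Definition connected_normal_unipotent G n (rho : G -> 'M[R]_n) (P H : set G) :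
  Prop :=
  [/\ subgroup H, H `<=` P,
      forall p h, P p -> H h -> H (p * h * p^-1)%g,
      connected H
    & forall h, H h -> unipotent (rho h)].

(* The largest connected normal unipotent subgroup of [P]. *)
Definition unipotent_radical G n (rho : G -> 'M[R]_n) (P U : set G) : Prop :=
  connected_normal_unipotent rho P U /\
  forall H, connected_normal_unipotent rho P H -> H `<=` U.

(* [N], embedded in [G] by [iota], is the unipotent radical of a parabolic
   subgroup of [G]. *)
Definition is_unipotent_radical G n (rho : G -> 'M[R]_n) N (iota : N -> G) :
  Prop :=
  [/\ injective iota,
      forall x y, iota (x * y)%g = (iota x * iota y)%g,
      forall x (A : set N), nbhs x A <->
        exists2 B, nbhs (iota x) B & iota @^-1` B `<=` A
    & exists2 P, parabolic_subgroup rho P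
               & unipotent_radical rho P (range iota)].

Definition trace_norm G m (sigma : G -> 'M[R[i]]_m) (g : G) : R :=
  let hs (A : 'M[R[i]]_m) := complex.Re (\tr (A *m (map_mx Num.conj A)^T)) in
  hs (sigma g) + hs (sigma (g^-1)%g).

Definition scale_le G (s s' : G -> R) : Prop :=
  exists (C : R) (k : nat), forall g, s g <= C * s' g ^+ k.

(* Algebraic scales are the scales equivalent to the trace norm of some
   finite-dimensional representation with finite kernel and closed image
   (in the general linear group). *)
Definition algebraic_scale G (s : G -> R) : Prop :=
  [/\ forall g, 0 < s g,
      forall g h, s (g * h)%g <= s g * s h,
      forall g : G, exists C : R, \forall h \near g, s h <= C
    & exists m (sigma : G -> 'M[R[i]]_m),
        [/\ matrix_rep sigma, continuous sigma,
            finite_set [set g | sigma g = 1%:M],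
            forall A, A \in unitmx -> closure (range sigma) A ->
              range sigma A
          & scale_le s (trace_norm sigma) /\ scale_le (trace_norm sigma) s]].

Section Smooth.
Variable V : tvsType R[i].

Definition has_deriv n (F : 'M[R]_n -> V) (A B : 'M[R]_n) (D : V) : Prop :=
  (t^-1)%:C *: (F (A + t *: B) - F A) @[t --> (0 : R)^'] --> D.

Fixpoint Ck_on n (k : nat) (U : set 'M[R]_n) (F : 'M[R]_n -> V) : Prop :=
  (forall A, U A -> {for A, continuous F}) /\
  if k is k'.+1 then
    forall B, exists2 F', forall A, U A -> has_deriv F A B (F' A)
                        & Ck_on k' U F'
  else True.

(* Smoothness (with all directional derivatives of all orders) of [f] on [N],
   viewed as a submanifold of ['M[R]_n] via [rho]:
   [f] is locally the restriction of a smooth map on an open set of ['M[R]_n]. *)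
Definition smooth_map N n (rho : N -> 'M[R]_n) (f : N -> V) : Prop :=
  forall g : N, exists (U : set 'M[R]_n) (F : 'M[R]_n -> V),
    [/\ open U, U (rho g), forall k, Ck_on k U F
      & \forall h \near g, f h = F (rho h)].
End Smooth.

Section Representation.
Variables (N : topGroupType) (V : tvsType R[i]) (act : N -> V -> V).

Definition continuous_linear_action : Prop :=
  [/\ forall v, act 1%g v = v,
      forall g h v, act (g * h)%g v = act g (act h v),
      forall g (a : R[i]) v w, act g (a *: v + w) = a *: act g v + act g w
    & continuous (fun x : N * V => act x.1 x.2)].

Definition moderate_growth (s : N -> R) : Prop :=
  forall p1 : V -> R, continuous_seminorm p1 ->
    exists (r : R) (p2 : V -> R), [/\ 0 <= r, continuous_seminorm p2
      & forall g v, p1 (act g v) <= s g `^ r * p2 v].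

Definition smooth_frechet_rep n (rho : N -> 'M[R]_n) (s : N -> R) : Prop :=
  [/\ frechet V,
      continuous_linear_action,
      forall v, smooth_map rho (act ^~ v)
    & moderate_growth s].

(* The action of the element of [Lie(N)] with one-parameter group [gamma]. *)
Definition lie_act (gamma : R -> N) (v : V) : V :=
  xget 0 [set w | (t^-1)%:C *: (act (gamma t) v - v) @[t --> (0 : R)^'] --> w].

Definition lie_monomials (k : nat) : set V :=
  [set w | exists (X : k.-tuple (R -> N)) (v : V),
     (forall i, one_param (tnth X i)) /\ w = foldr lie_act v X].

(* The closure of [n^k . V], i.e. of the span of the [X_1 ... X_k . v]. *)
Definition lie_power_closure (k : nat) : submodule V :=
  closed_span (lie_monomials k).

Definition CJs : {pred V} := [pred v | `[< forall k, v \in lie_power_closure k >]].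

Fact CJs_submod : submod_closed CJs.
Proof.
split; first by apply/asboolP => k; exact: rpred0.
move=> a x y /asboolP xC /asboolP yC; apply/asboolP => k.
by have [_] := submoduleP (lie_power_closure k); apply.
Qed.

Definition CJ_submodule : submodule V := Submodule CJs_submod.

End Representation.
End Groups.

(* Main.v *)
(* By moderate growth, orbit maps grow polynomially on N, with an exponent E
   depending only on the seminorm. If a seminorm q kills n^(M+1) V, then modulo q
     (u_1^k - 1) ... (u_M^k - 1) v = k^M (u_1 - 1) ... (u_M - 1) v
   for u_i in one-parameter subgroups of N; as the left side is O(k^E), q kills
   n^M V as soon as M > E. For q the distance to n^m' V relative to a seminorm p,
   this gives an m, depending only on p, such that n^m' V is p-dense in n^m V for
   all m' >= m. A Mittag-Leffler argument makes the intersection of the closures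
   p-dense in n^m V, so the quotient seminorm of p vanishes on n^m V.
   That E does not depend on the number of factors is due to unipotence: long
   products of the matrices u_i - 1 vanish by Kolchin's theorem, so the norm of
   u_1^k ... u_M^k is bounded by a power of k that depends only on the matrix size.
   A scale on G is bounded by a power of the norm of the given representation,
   through the polar decomposition. *)

Require Import Defs.
From mathcomp Require Import all_boot all_order all_algebra.
From mathcomp Require Import all_classical all_reals topology.
From mathcomp Require Import interval_inference.
From mathcomp Require Import normedtype tvs derive realfun exp complex.
From mathcomp Require Import lra ring zify.
From mathcomp Require Import measure lebesgue_measure lebesgue_integral ftc.
From mathcomp Require mpoly spectral.
Import Order.TTheory GRing.Theory Num.Theory.
Import numFieldNormedType.Exports.
Set Implicit Arguments.
Unset Strict Implicit.
Unset Printing Implicit Defensive.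
Local Open Scope classical_set_scope.
Local Open Scope ring_scope.

(** * Exponential sums *)

(** Moderate growth bounds group elements and not derivatives, which is why powers of the Lie
    algebra give way to powers of the augmentation ideal. The two have the same closed spans: a
    derivative is a limit of difference quotients, and conversely a mean value inequality for the
    distance to [lspan (lie_set k.+1)] shows that [u - 1] raises the order by one. This uses that
    [lie_set] is stable under [N], as conjugation permutes one-parameter groups. One-parameter
    groups are only continuous by definition, and smoothness of an orbit map only provides
    directional derivatives of a local extension to matrices. Hence the differentiability of
    continuous matrix groups, the mean value inequality for a seminorm and the chain rule. The scale
    comes from a representation unrelated to [rho]. Submultiplicativity reduces the comparison to
    counting how many factors near the identity make up [g]; these factors are real powers of a Gram
    matrix, which must lie in the algebraic group to be lifted through [rho]. All estimates concern
    one seminorm at a time, because the order [m] depends on the seminorm. *)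

Lemma interpolation (K : fieldType) (s : seq K) (f : K -> K) :
  exists p : {poly K}, forall x, x \in s -> p.[x] = f x.
Proof.
elim: s => [|a s [p ps]]; first by exists 0.
have [as_|as_] := boolP (a \in s).
  by exists p => x; rewrite inE => /orP[/eqP ->|]; exact: ps.
(* [w] vanishes on [s] and not at [a], so a multiple of it corrects the value at [a] alone. *)
pose w : {poly K} := \prod_(b <- s) ('X - b%:P).
have wa : w.[a] != 0 by rewrite -rootE root_prod_XsubC.
exists (p + ((f a - p.[a]) / w.[a])%:P * w) => x.
rewrite inE hornerD hornerM hornerC => /orP[/eqP ->|xs].
  by rewrite divfK // addrC subrK.
have /eqP -> : w.[x] == 0 by rewrite -rootE root_prod_XsubC.
by rewrite mulr0 addr0 ps.
Qed.

Section ExpSum.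
Variable R : realType.

(** The form taken by the entries of the real powers of a positive definite matrix, with the
    eigenvalues as bases. Positive bases make [powR] multiplicative in the base and equal to the
    ordinary power at naturals. *)
Definition exp_sum (h : R -> R) : Prop :=
  exists2 l : seq (R * R), forall x, x \in l -> 0 < x.2 &
    forall s, h s = \sum_(x <- l) x.1 * x.2 `^ s.

(* On the finitely many bases of [h], the function [x |-> x `^ s] agrees with a
   polynomial, so that [h s] is a combination of values of [h] at naturals. *)
Lemma exp_sum_eq0 h : exp_sum h -> (forall k : nat, h k%:R = 0) ->
  forall s, h s = 0.
Proof.
move=> [l lpos hE] h0 s.
have [p ps] := interpolation (map snd l) (fun x => x `^ s).
transitivity (\sum_(i < size p) p`_i * h i%:R); last first.
  by rewrite big1 // => i _; rewrite h0 mulr0.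
rewrite hE; under [RHS]eq_bigr do rewrite hE big_distrr /=.
rewrite exchange_big /=; apply: eq_big_seq => x xl.
rewrite -(ps _ (map_f snd xl)) horner_coef big_distrr /=.
apply: eq_bigr => i _; rewrite powR_mulrn ?(ltW (lpos _ xl)) //; ring.
Qed.

Lemma exp_sum_cst c : exp_sum (fun=> c).
Proof.
exists [:: (c, 1)] => [x|s]; first by rewrite inE => /eqP ->.
by rewrite big_seq1 powR1 mulr1.
Qed.

Lemma exp_sum_powR x : 0 < x -> exp_sum (powR x).
Proof.
move=> x0; exists [:: (1, x)] => [y|s]; first by rewrite inE => /eqP ->.
by rewrite big_seq1 mul1r.
Qed.

Lemma exp_sumD g h : exp_sum g -> exp_sum h -> exp_sum (fun s => g s + h s).
Proof.
move=> [l lp gE] [m mp hE]; exists (l ++ m).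
  by move=> x; rewrite mem_cat => /orP[/lp|/mp].
by move=> s; rewrite big_cat /= gE hE.
Qed.

Lemma exp_sumM g h : exp_sum g -> exp_sum h -> exp_sum (fun s => g s * h s).
Proof.
move=> [l lp gE] [m mp hE].
exists [seq (x.1 * y.1, x.2 * y.2) | x <- l, y <- m].
  by move=> _ /allpairsP[[x y] [/= /lp x0 /mp y0 ->]]; exact: mulr_gt0.
move=> s; rewrite gE hE big_allpairs_dep big_distrl /=; apply: eq_big_seq => x xl.
rewrite big_distrr /=; apply: eq_big_seq => y ym.
by rewrite /= (powRM _ (ltW (lp _ xl)) (ltW (mp _ ym))) mulrACA.
Qed.

Lemma exp_sum_sum (I : Type) (r : seq I) (h : I -> R -> R) :
  (forall i, exp_sum (h i)) -> exp_sum (fun s => \sum_(i <- r) h i s).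
Proof.
move=> hh; elim: r => [|i r IH].
  by under eq_fun do rewrite big_nil; exact: exp_sum_cst.
by under eq_fun do rewrite big_cons; exact: exp_sumD.
Qed.

Lemma exp_sumX h k : exp_sum h -> exp_sum (fun s => h s ^+ k).
Proof.
move=> hh; elim: k => [|k IH].
  by under eq_fun do rewrite expr0; exact: exp_sum_cst.
by under eq_fun do rewrite exprS; exact: exp_sumM.
Qed.

Lemma exp_sum_prod (I : Type) (r : seq I) (h : I -> R -> R) :
  (forall i, exp_sum (h i)) -> exp_sum (fun s => \prod_(i <- r) h i s).
Proof.
move=> hh; elim: r => [|i r IH].
  by under eq_fun do rewrite big_nil; exact: exp_sum_cst.
by under eq_fun do rewrite big_cons; exact: exp_sumM.
Qed.

Lemma exp_sum_meval n (f : mpoly.mpoly n R) (h : 'I_n -> R -> R) :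
  (forall i, exp_sum (h i)) ->
  exp_sum (fun s => mpoly.meval (fun i => h i s) f).
Proof.
move=> hh; under eq_fun do rewrite mpoly.mevalE.
by apply: exp_sum_sum => m; apply: exp_sumM; [exact: exp_sum_cst|
  apply: exp_sum_prod => i; exact: exp_sumX].
Qed.

End ExpSum.

(** * Real powers of a Gram matrix *)

Section SpectralCalculus.
Variable R : realType.
Local Open Scope complex_scope.
Import spectral sesquilinear.
Local Open Scope sesquilinear_scope.

Local Notation iota := (map_mx (real_complex R)).

Lemma map_real_complex_inj m n : injective (@map_mx R R[i] (real_complex R) m n).
Proof.
move=> A B /matrixP AB; apply/matrixP => i j.
by have := AB i j; rewrite !mxE => -[].
Qed.

Lemma conj_real_complex (x : R) : Num.conj (x%:C) = x%:C.
Proof. by apply/CrealP; rewrite complex_real. Qed.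

Section Calculus.
Variables (n : nat) (A : 'M[R]_n) (U : 'M[R[i]]_n) (lam : 'I_n -> R).
Let B : 'M[R]_n := A^T *m A.
Hypothesis Aunit : A \in unitmx.
Hypothesis U_unit : U \in unitmx.
Hypothesis invU : forall i k, invmx U i k = Num.conj (U k i).
Hypothesis BE : iota B = invmx U *m diag_mx (\row_k (lam k)%:C) *m U.

(** Functional calculus of [B]: [f] is applied to the eigenvalues. It lives over the complex numbers
    because the diagonalization does, and [calc_real] brings it back to real matrices. *)
Let calc (f : R -> R) : 'M[R[i]]_n :=
  invmx U *m diag_mx (\row_k (f (lam k))%:C) *m U.

Let calcE f i j :
  calc f i j = \sum_k (f (lam k))%:C * (Num.conj (U k i) * U k j).
Proof.
rewrite /calc mxE; apply: eq_bigr => k _.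
by rewrite mul_mx_diag !mxE invU mulrAC mulrC mulrA.
Qed.

Let eq_calc f g : (forall k, f (lam k) = g (lam k)) -> calc f = calc g.
Proof.
move=> fg; rewrite /calc.
by have -> : \row_k (f (lam k))%:C = \row_k (g (lam k))%:C by apply/rowP => k; rewrite !mxE fg.
Qed.

Let calcM f g : calc f *m calc g = calc (fun x => f x * g x).
Proof.
have conjM (D E : 'M[R[i]]_n) : (invmx U *m D *m U) *m (invmx U *m E *m U) =
    invmx U *m (D *m E) *m U.
  by rewrite !mulmxA mulmxK.
have e : \row_k (f (lam k) * g (lam k))%:C =
    \row_k ((\row_k (f (lam k))%:C) 0 k * (\row_k (g (lam k))%:C) 0 k) :> 'rV[R[i]]_n.
  by apply/rowP => k; rewrite !mxE rmorphM.
by rewrite conjM mulmx_diag -e.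
Qed.

Let calc1 : calc (fun=> 1) = 1%:M.
Proof.
rewrite /calc (_ : diag_mx _ = 1%:M) ?mulmx1 ?mulVmx //.
by rewrite -diag_const_mx; congr diag_mx; apply/rowP => k; rewrite !mxE.
Qed.

Let calc_id : calc id = iota B.
Proof. by rewrite BE. Qed.

(** Since [U] is unitary, [lam k] is the squared norm of the [k]-th row of [U *m (iota A)^T]; it is
    nonzero because [B] is invertible. *)
Let lam_gt0 k : 0 < lam k.
Proof.
have UB : U *m iota B *m invmx U = diag_mx (\row_k (lam k)%:C).
  by rewrite -calc_id /calc !mulmxA mulmxV // mul1mx mulmxK.
have le0 : 0 <= (lam k)%:C.
  have /matrixP/(_ k k) := UB; rewrite mxE [in RHS]mxE eqxx mulr1n mxE => <-.
  rewrite /B map_mxM -map_trmx mulmxA.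
  under eq_bigr => j _ do rewrite invU.
  set W := U *m (iota A)^T.
  have -> : \sum_j (W *m iota A) k j * Num.conj (U k j) =
            \sum_j W k j * Num.conj (W k j).
    under eq_bigr => j _ do rewrite mxE big_distrl /=.
    rewrite exchange_big /=; apply: eq_bigr => j _.
    under eq_bigr => i _ do rewrite -mulrA.
    rewrite -big_distrr /= [in Num.conj _]mxE rmorph_sum /=; congr (_ * _).
    by apply: eq_bigr => i _; rewrite rmorphM /= !mxE conj_real_complex mulrC.
  by apply: sumr_ge0 => j _; exact: mul_conjC_ge0.
have ne0 : (lam k)%:C != 0.
  have : diag_mx (\row_k (lam k)%:C) \in unitmx.
    rewrite -UB !unitmx_mul U_unit unitmx_inv U_unit andbT /= /B.
    by rewrite map_unitmx unitmx_mul unitmx_tr Aunit.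
  rewrite unitmxE det_diag unitfE => /prodf_neq0/(_ k isT).
  by rewrite mxE.
have : 0 < (lam k)%:C by rewrite lt0r ne0.
by rewrite ltcR.
Qed.

Let calc_tr f : \tr (calc f) = (\sum_k f (lam k))%:C.
Proof.
rewrite /calc mxtrace_mulC mulmxA mulmxV // mul1mx mxtrace_diag rmorph_sum.
by apply: eq_bigr => k _; rewrite mxE.
Qed.

Let calcX i : calc (fun x => x ^+ i) = iota (iter i (mulmx B) 1%:M).
Proof.
elim: i => [|i IH] /=; first by rewrite map_mx1 -calc1.
rewrite map_mxM -calc_id -IH calcM; apply: eq_calc => k /=.
by rewrite exprS.
Qed.

(** A real polynomial interpolating [f] on the spectrum makes [calc f] a real polynomial in the real
    matrix [B]. *)
Let calc_real f : exists Q, calc f = iota Q.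
Proof.
have [p pf] := interpolation [seq lam k | k : 'I_n] f.
exists (\sum_(i < size p) p`_i *: iter i (mulmx B) 1%:M).
apply/matrixP => a b; rewrite [RHS]mxE summxE rmorph_sum /=.
transitivity (\sum_(i < size p) (p`_i)%:C * calc (fun x => x ^+ i) a b).
  rewrite calcE; under [RHS]eq_bigr do rewrite calcE big_distrr /=.
  rewrite exchange_big /=; apply: eq_bigr => k _.
  rewrite -pf; last by apply/mapP; exists k => //; rewrite mem_enum.
  rewrite horner_coef rmorph_sum /= big_distrl /=; apply: eq_bigr => i _.
  by rewrite rmorphM /= mulrA.
by apply: eq_bigr => i _; rewrite calcX !mxE rmorphM.
Qed.

Let U_le1 k i : `|U k i| <= 1.
Proof.
have : (U *m invmx U) k k = 1 by rewrite mulmxV // mxE eqxx.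
rewrite mxE (bigD1 i) //= invU -normCK => e1.
rewrite -(@expr_le1 _ 2) //; rewrite -e1 lerDl.
by apply: sumr_ge0 => j _; rewrite invU mul_conjC_ge0.
Qed.

(** The last clause says that an [m]-th root of the Gram matrix is near the identity as soon as [m]
    is logarithmic in the traces: these bound every eigenvalue and its inverse by [c ^+ m], so the
    eigenvalues of the root lie between [c^-1] and [c]. *)
Lemma positive_powers_diag : exists P : R -> 'M[R]_n,
  [/\ P 0 = 1%:M, P 1 = A^T *m A, forall s t, P (s + t) = P s *m P t,
      forall s, (P s)^T = P s &
      (forall i j, exp_sum (fun s => P s i j)) /\
      forall (c : R) (m : nat), 1 <= c -> (0 < m)%N -> \tr (A^T *m A) <= c ^+ m ->
        \tr (invmx A *m (invmx A)^T) <= c ^+ m ->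
        forall i j, `|(P m%:R^-1 - 1%:M) i j| <= n%:R * (c - 1)].
Proof.
have [Q QE] := boolp.choice calc_real.
have QM f g : Q (fun x => f x * g x) = Q f *m Q g.
  by apply: map_real_complex_inj; rewrite map_mxM -!QE calcM.
have Qeq f g : (forall k, f (lam k) = g (lam k)) -> Q f = Q g.
  move=> fg; apply: map_real_complex_inj; rewrite -!QE; exact: eq_calc.
have Q1 : Q (fun=> 1) = 1%:M.
  by apply: map_real_complex_inj; rewrite -QE calc1 map_mx1.
have Qid : Q id = B by apply: map_real_complex_inj; rewrite -QE calc_id.
have Qtr f : \tr (Q f) = \sum_k f (lam k).
  have : \tr (iota (Q f)) = (\sum_k f (lam k))%:C by rewrite -QE calc_tr.
  by rewrite trace_map_mx => -[].
have QijE f i j : Q f i j =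
    \sum_k f (lam k) * complex.Re (Num.conj (U k i) * U k j).
  have /(congr1 (@complex.Re R)) : calc f i j = (Q f i j)%:C by rewrite QE mxE.
  rewrite calcE /= => <-; rewrite raddf_sum; apply: eq_bigr => k _.
  by case: (Num.conj _ * _) => a b; rewrite /= mul0r subr0.
exists (fun s => Q (fun x => x `^ s)); split.
- by rewrite -Q1; apply: Qeq => k; rewrite powRr0.
- by rewrite -/B -Qid; apply: Qeq => k; rewrite powRr1 // ltW.
- move=> s t; rewrite -QM; apply: Qeq => k.
  by rewrite powRD //; apply/implyP => _; rewrite gt_eqF.
- move=> s; apply/matrixP => i j; rewrite mxE !QijE; apply: eq_bigr => k _.
  congr (_ * _); rewrite [in RHS]mulrC -[in RHS](conjCK (U k j)) -rmorphM.
  by case: (Num.conj _ * _).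
- split=> [i j|c m c1 m0 trB trV i j].
    under eq_fun do rewrite QijE; apply: exp_sum_sum => k.
    by apply: exp_sumM; [exact: exp_sum_powR|exact: exp_sum_cst].
  have c0 : 0 < c by rewrite (lt_le_trans _ c1).
  have powm (x : R) : 0 < x -> x <= c ^+ m -> x `^ m%:R^-1 <= c.
    move=> x0 xc; have -> : c = (c ^+ m) `^ m%:R^-1.
      rewrite -powR_mulrn ?ltW // -powRrM mulfV ?powRr1 ?ltW //.
      by rewrite pnatr_eq0 -lt0n.
    by apply: ge0_ler_powR; rewrite ?invr_ge0 ?nnegrE ?(ltW x0) ?exprn_ge0 ?(ltW c0).
  have le1 k : lam k `^ m%:R^-1 <= c.
    apply: powm => //; apply: le_trans trB; rewrite -/B -Qid Qtr.
    rewrite (bigD1 k) //= lerDl; apply: sumr_ge0 => l _; exact/ltW.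
  have le2 k : (lam k `^ m%:R^-1)^-1 <= c.
    have e1 : lam k `^ m%:R^-1 * (lam k)^-1 `^ m%:R^-1 = 1.
      by rewrite -powRM ?invr_ge0 ?ltW // mulfV ?powR1 // gt_eqF.
    have -> : (lam k `^ m%:R^-1)^-1 = (lam k)^-1 `^ m%:R^-1.
      have ne : lam k `^ m%:R^-1 != 0 by rewrite gt_eqF // powR_gt0.
      by apply: (mulfI ne); rewrite mulfV // e1.
    apply: powm; first by rewrite invr_gt0.
    apply: le_trans trV.
    have -> : invmx A *m (invmx A)^T = Q (fun x => x^-1).
      have BQ : B *m Q (fun x => x^-1) = 1%:M.
        by rewrite -Qid -QM -Q1; apply: Qeq => l; rewrite mulfV // gt_eqF.
      have BV : (invmx A *m (invmx A)^T) *m B = 1%:M.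
        rewrite /B mulmxA -(mulmxA _ _ A^T) -trmx_mul mulmxV // trmx1 mulmx1.
        by rewrite mulVmx.
      by rewrite -[LHS]mulmx1 -BQ mulmxA BV mul1mx.
    rewrite Qtr (bigD1 k) //= lerDl; apply: sumr_ge0 => l _.
    by rewrite invr_ge0 ltW.
  rewrite -Q1 !mxE !QijE -sumrB.
  apply: le_trans (ler_norm_sum _ _ _) _.
  have -> : n%:R * (c - 1) = \sum_(k < n) (c - 1).
    by rewrite sumr_const card_ord mulr_natl.
  apply: ler_sum => k _; rewrite -mulrBl normrM.
  rewrite -[leRHS]mulr1; apply: ler_pM => //.
    have := le1 k; have := le2 k; have := powR_gt0 m%:R^-1 (lam_gt0 k).
    set x := _ `^ _ => x0 h2 h1; rewrite ler_norml; apply/andP; split; last by rewrite lerD2r.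
    by move: h2; rewrite -[x^-1]mul1r ler_pdivrMr // => h2; nra.
  rewrite -lecR; apply: le_trans (normc_ge_Re _) _.
  by rewrite normrM norm_conjC mulr_ile1.
Qed.

End Calculus.

Lemma gram_diagonalization n (B : 'M[R]_n) : B^T = B ->
  exists (U : 'M[R[i]]_n) (lam : 'I_n -> R),
  [/\ U \in unitmx, forall i k, invmx U i k = Num.conj (U k i) &
    iota B = invmx U *m diag_mx (\row_k (lam k)%:C) *m U].
Proof.
move=> /matrixP symB.
have herm : iota B \is hermsymmx.
  apply/is_hermitianmxP; rewrite expr0 scale1r.
  apply/matrixP => i j; rewrite !mxE conj_real_complex; congr (_%:C).
  by rewrite -symB mxE.
exists (spectralmx (iota B)), (fun k => complex.Re (spectral_diag (iota B) 0 k)).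
split=> [|i k|].
- exact: spectral_unit.
- by rewrite invmx_unitary ?spectral_unitarymx // !mxE.
have /orthomx_spectralP e := hermitian_normalmx herm.
rewrite [LHS]e; congr (_ *m diag_mx _ *m _); apply/rowP => k; rewrite mxE.
have /mxOverP/(_ 0 k) := hermitian_spectral_diag_real herm.
by move=> /complex_realP [x ->].
Qed.

Lemma positive_powers n (A : 'M[R]_n) : A \in unitmx ->
  exists P : R -> 'M[R]_n,
  [/\ P 0 = 1%:M, P 1 = A^T *m A, forall s t, P (s + t) = P s *m P t,
      forall s, (P s)^T = P s &
      (forall i j, exp_sum (fun s => P s i j)) /\
      forall (c : R) (m : nat), 1 <= c -> (0 < m)%N -> \tr (A^T *m A) <= c ^+ m ->
        \tr (invmx A *m (invmx A)^T) <= c ^+ m ->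
        forall i j, `|(P m%:R^-1 - 1%:M) i j| <= n%:R * (c - 1)].
Proof.
move=> Aunit; have [|U [lam [U_unit invU BE]]] := @gram_diagonalization n (A^T *m A).
  by rewrite trmx_mul trmxK.
exact: positive_powers_diag BE.
Qed.
End SpectralCalculus.

(** * Growth of scales on reductive groups *)

Section ReductiveScale.
Variable R : realType.

Lemma exprn_unbounded (c x : R) : 1 < c -> exists k, x <= c ^+ k.
Proof.
move=> c1; have c0 : 0 < c - 1 by rewrite subr_gt0.
have bern k : 1 + k%:R * (c - 1) <= c ^+ k.
  elim: k => [|k IH]; first by rewrite mul0r addr0.
  have k0 : 0 <= k%:R :> R by [].
  have k1 : 0 <= k%:R * (c - 1) ^+ 2 by rewrite mulr_ge0 ?sqr_ge0.
  have c00 : 0 <= c by rewrite ltW // (lt_trans ltr01).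
  rewrite exprS -natr1; apply: le_trans (ler_wpM2l c00 IH); lra.
pose k := (Num.truncn (`|x| / (c - 1))).+1; exists k.
apply: le_trans (bern k); apply: le_trans (ler_norm x) _.
apply: (@le_trans _ _ (k%:R * (c - 1))); last by rewrite lerDr.
rewrite -ler_pdivrMr // ltW //.
have /andP[_] := Num.Theory.truncn_itv (divr_ge0 (normr_ge0 x) (ltW c0)).
by rewrite /k.
Qed.

Lemma rep_unit (G : topGroupType) n (rho : G -> 'M[R]_n) g :
  matrix_rep rho -> rho g \in unitmx /\ invmx (rho g) = rho (g^-1)%g.
Proof.
move=> [r1 rM]; have e : rho g *m rho (g^-1)%g = 1%:M by rewrite -rM mulgV.
have [u _] := mulmx1_unit e; split=> //.
by rewrite -[RHS](mulKmx u) e mulmx1.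
Qed.

Lemma gramE n (A : 'M[R]_n) : \tr (A^T *m A) = \sum_i \sum_j A j i ^+ 2.
Proof.
apply: eq_bigr => i _; rewrite mxE; apply: eq_bigr => j _.
by rewrite mxE expr2.
Qed.

Lemma gram_ge0 n (A : 'M[R]_n) : 0 <= \tr (A^T *m A).
Proof.
by rewrite gramE; apply: sumr_ge0 => i _; apply: sumr_ge0 => j _; exact: sqr_ge0.
Qed.

Lemma orthogonal_entry_le1 n (A : 'M[R]_n) : A^T *m A = 1%:M ->
  forall i j, `|A i j| <= 1.
Proof.
move=> AA i j; rewrite -(@expr_le1 _ 2) // -normrX ger0_norm ?sqr_ge0 //.
have /matrixP/(_ j j) := AA; rewrite mxE [in RHS]mxE eqxx mulr1n => <-.
rewrite (bigD1 i) //= mxE expr2 lerDl; apply: sumr_ge0 => k _.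
by rewrite mxE -expr2 sqr_ge0.
Qed.

(* The entries of [P] are exponential sums, so the polynomial equations of [S]
   pass from the integer powers of [P 1] to the real ones. *)
Lemma algebraic_powers n (S : set 'M[R]_n) (P : R -> 'M[R]_n) :
  self_adjoint_algebraic_group S ->
  P 0 = 1%:M -> (forall s t, P (s + t) = P s *m P t) ->
  (forall i j, exp_sum (fun s => P s i j)) -> S (P 1) ->
  forall s, S (P s).
Proof.
move=> [[F SF] S1 SM _ _] P0 PD Pexp SP1 s.
have Pnat (k : nat) : S (P k%:R).
  by elim: k => [|k IH]; rewrite ?P0 // -natr1 PD; exact: SM.
have Punit t : P t \in unitmx.
  have e : P t *m P (- t) = 1%:M by rewrite -PD subrr.
  by have [] := mulmx1_unit e.
rewrite SF; split=> // f Ff.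
apply: (exp_sum_eq0 (h := fun s => mpoly.meval (fun i => mxvec (P s) 0 i) f)).
  apply: exp_sum_meval => i; case/mxvec_indexP: i => a b.
  by under eq_fun do rewrite mxvecE.
by move=> k; have := Pnat k; rewrite SF => -[_]; exact.
Qed.

Lemma mulmx_entry_lt m n p (A : 'M[R]_(m, n)) (B : 'M[R]_(n, p)) (a b : R) :
  0 <= a -> (forall i j, `|A i j| <= a) -> (forall i j, `|B i j| <= b) ->
  forall i j, `|(A *m B) i j| <= n%:R * (a * b).
Proof.
move=> a0 Aa Bb i j; rewrite mxE; apply: le_trans (ler_norm_sum _ _ _) _.
rewrite mulr_natl -[X in _ *+ X]card_ord -sumr_const; apply: ler_sum => k _.
by rewrite normrM ler_pM.
Qed.

(** Stands in for compactness of the orthogonal group, whose matrices have entries in [-1, 1]: it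
    records the cube of side [N^-1] that contains [A], in a finite grid. The entry 1 reaches the
    index [2 * N], hence the successor in the index type. *)
Definition cell n N (A : 'M[R]_n) : {ffun 'I_n * 'I_n -> 'I_(2 * N).+1} :=
  [ffun p => inord (Num.truncn (N%:R * (A p.1 p.2 + 1)))].

Lemma cell_close n N (A B : 'M[R]_n) : (0 < N)%N ->
  (forall i j, `|A i j| <= 1) -> (forall i j, `|B i j| <= 1) ->
  cell N A = cell N B -> forall i j, `|A i j - B i j| <= N%:R^-1.
Proof.
move=> N0 A1 B1 /ffunP AB i j; have NR : 0 < N%:R :> R by rewrite ltr0n.
have rng (x : R) : `|x| <= 1 -> 0 <= N%:R * (x + 1) /\
    (Num.truncn (N%:R * (x + 1)) < (2 * N).+1)%N.
  rewrite ler_norml => /andP[x1 x2]; have x0 : 0 <= N%:R * (x + 1) by nra.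
  split=> //; rewrite ltnS -(ler_nat R).
  have /andP[h _] := Num.Theory.truncn_itv x0.
  by apply: le_trans h _; rewrite natrM; nra.
have [a0 aN] := rng _ (A1 i j); have [b0 bN] := rng _ (B1 i j).
have := AB (i, j); rewrite !ffunE /= => /(congr1 val) /=; rewrite !inordK // => e.
have /andP[ha ha'] := Num.Theory.truncn_itv a0.
have /andP[hb hb'] := Num.Theory.truncn_itv b0.
rewrite e in ha ha'; rewrite -(ler_pM2l NR) mulfV ?gt_eqF //.
rewrite -[X in X * _](ger0_norm (ltW NR)) -normrM ler_norml.
set x := _%:R in ha ha' hb hb'.
move: ha' hb'; rewrite -natr1 -/x => ha' hb'.
by apply/andP; split; lra.
Qed.

Section Scale.
Variables (G : topGroupType) (n : nat) (rho : G -> 'M[R]_n) (s : G -> R).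
Hypothesis red : real_reductive rho.
Hypothesis s_gt0 : forall g, 0 < s g.
Hypothesis sM : forall g h, s (g * h)%g <= s g * s h.
Hypothesis s_loc : forall g : G, exists C : R, \forall h \near g, s h <= C.

Lemma finite_scale_bound (A : set G) : finite_set A ->
  exists2 Z, 0 < Z & forall g, A g -> s g <= Z.
Proof.
move=> /finite_seqP [l ->]; exists (1 + \sum_(z <- l) s z) => [|g /= gl].
  by rewrite ltr_pwDl // sumr_ge0 // => z _; exact/ltW.
rewrite (big_rem g) //= addrCA lerDl addr_ge0 // sumr_ge0 // => z _; exact/ltW.
Qed.

(* Two elements of [G] with orthogonal images in the same cell differ by an
   element of [U] times an element of the finite kernel. *)
Lemma orthogonal_scale_bound (U : set G) (C0 d : R) :
  0 < C0 -> 0 < d -> (forall u, U u -> s u <= C0) ->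
  (forall g, (forall i j, `|(rho g - 1%:M) i j| < d) -> exists2 u, U u & rho u = rho g) ->
  exists2 C, 0 < C & forall g, (rho g)^T *m rho g = 1%:M -> s g <= C.
Proof.
move=> C00 d0 sU liftU; have [_ rep _ ker _] := red; have [r1 rM] := rep.
have [Z Z0 kerZ] := finite_scale_bound ker.
(* For [g] and [k] in one cell, each entry of [(rho k)^T *m (rho g - rho k)] is a sum of [n] terms
   of size at most [N^-1]; this [N] makes the sum less than [d]. *)
pose N := (Num.truncn (n%:R / d)).+1.
have NR : n%:R * N%:R^-1 < d.
  rewrite ltr_pdivrMr ?ltr0n // mulrC -ltr_pdivrMr //.
  by rewrite /N; have /andP[] := Num.Theory.truncn_itv (divr_ge0 (ler0n R n) (ltW d0)).
have bnd (f : {ffun 'I_n * 'I_n -> 'I_(2 * N).+1}) : exists b : R,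
    forall g, (rho g)^T *m rho g = 1%:M -> cell N (rho g) = f -> s g <= b.
  have [[k [kO kf]]|no] := pselect (exists k, (rho k)^T *m rho k = 1%:M /\
      cell N (rho k) = f); last first.
    by exists 0 => g gO gf; exfalso; apply: no; exists g.
  exists (s k * (C0 * Z)) => g gO gf.
  have kV : rho (k^-1)%g = (rho k)^T.
    have [ku kV] := rep_unit k rep.
    by rewrite -kV -[LHS]mul1mx -kO mulmxK.
  have [i j|u Uu ue] := liftU (k^-1 * g)%g.
    rewrite rM kV -kO -mulmxBr; apply: le_lt_trans NR.
    rewrite -[N%:R^-1]mul1r; apply: mulmx_entry_lt => // a b.
      by rewrite mxE orthogonal_entry_le1.
    have -> : (rho g - rho k) a b = rho g a b - rho k a b by rewrite !mxE.
    by apply: (cell_close (N := N)) => //; rewrite ?gf ?kf //;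
      exact: orthogonal_entry_le1.
  have gE : g = (k * (u * (u^-1 * (k^-1 * g))))%g by rewrite mulVKg mulVKg.
  have zZ : s (u^-1 * (k^-1 * g))%g <= Z.
    apply: kerZ; have [uu uV] := rep_unit u rep.
    by rewrite /= rM -uV -ue mulVmx.
  rewrite gE; apply: le_trans (sM _ _) _; rewrite ler_pM2l //.
  apply: le_trans (sM _ _) _; apply: ler_pM => //; try exact/ltW.
  exact: sU.
have [b bP] := boolp.choice bnd.
exists (1 + \sum_f `|b f|) => [|g gO]; first by rewrite ltr_pwDl // sumr_ge0.
apply: le_trans (bP _ _ gO erefl) _; apply: le_trans (ler_norm _) _.
rewrite (bigD1 (cell N (rho g))) //= addrCA lerDl addr_ge0 // sumr_ge0 //.
Qed.

Lemma scaleX g k : s (g ^+ k.+1)%g <= s g ^+ k.+1.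
Proof.
elim: k => [|k IH]; first by rewrite expg1 expr1.
by rewrite expgS exprS; apply: le_trans (sM _ _) _; rewrite ler_pM2l.
Qed.

(* Polar decomposition: [rho g] is orthogonal times the square root of its Gram
   matrix, which is the [M.+1]-st power of an element near the identity with [M]
   of order [ln tau]. Each factor multiplies [scale] by at most a constant. *)
Lemma reductive_scale_growth : exists (C : R) (d : nat), 0 < C /\ forall g,
  s g <= C * (1 + \tr ((rho g)^T *m rho g)
                + \tr ((rho (g^-1)%g)^T *m rho (g^-1)%g)) ^+ d.
Proof.
have [_ rep _ _ [S Sgrp Sopen]] := red; have [r1 rM] := rep.
have [F_ S1 SM _ ST] := Sgrp.
have Srho g : S (rho g).
  have [V _ e] := Sopen setT openT.
  by have : (rho @` setT) (rho g) by [exists g]; rewrite e => -[].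
have [C1 C1near] := s_loc 1%g.
pose C0 := Num.max 1 C1.
have C01 : 1 <= C0 by rewrite le_max lexx.
have [U0 [U0open U01] U0C] : exists2 U0, open_nbhs (1%g : G) U0 & forall u, U0 u -> s u <= C0.
  have : nbhs (1%g : G) [set h | s h <= C1] by [].
  rewrite nbhsE => -[U0 oU0 sub]; exists U0 => // u /sub /= h.
  by rewrite le_max h orbT.
have [V0 V0open rhoU0] := Sopen U0 U0open.
have V01 : V0 1%:M.
  by have : (rho @` U0) (rho 1%g) by [exists 1%g]; rewrite rhoU0 r1 => -[].
have [d d0 dV] : exists2 d, 0 < d & forall B : 'M[R]_n,
    (forall i j, `|(B - 1%:M) i j| < d) -> V0 B.
  have : nbhs (1%:M : 'M[R]_n) V0 by exact: open_nbhs_nbhs.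
  move=> /nbhs_ballP [d d0 sub]; exists d => // B Bd; apply: sub; split=> // i j.
  by rewrite -ball_normE /= distrC; have := Bd i j; rewrite !mxE.
have liftU g : (forall i j, `|(rho g - 1%:M) i j| < d) ->
    exists2 u, U0 u & rho u = rho g.
  move=> gd; have : (S `&` V0) (rho g) by split; [exact: Srho|exact: dV].
  by rewrite -rhoU0 => -[u]; exists u.
have C00 : 0 < C0 by rewrite (lt_le_trans ltr01).
have [CK CK0 KP] := orthogonal_scale_bound C00 d0 U0C liftU.
(* Eigenvalues between [c^-1] and [c] put a positive matrix within [n%:R * (c - 1)] of the identity;
   dividing by [n.+1] keeps this strictly below [d]. *)
pose c := 1 + d / n.+1%:R.
have c1 : 1 < c by rewrite ltrDl divr_gt0 // ltr0n.
have c0 : 0 < c by rewrite (lt_trans ltr01).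
have nc : n%:R * (c - 1) < d.
  rewrite /c addrAC subrr add0r mulrCA gtr_pMr // ltr_pdivrMr ?ltr0n // mul1r.
  by rewrite ltr_nat.
have [d0' C0d] := exprn_unbounded C0 c1.
exists (CK * (c ^+ 2) ^+ d0'), d0'; split.
  by rewrite mulr_gt0 // !exprn_gt0.
move=> g; set tau := (X in _ * X ^+ _).
have t1 : 0 <= \tr ((rho g)^T *m rho g) by exact: gram_ge0.
have t2 : 0 <= \tr ((rho (g^-1)%g)^T *m rho (g^-1)%g) by exact: gram_ge0.
have tau1 : 1 <= tau by rewrite /tau; lra.
have exM : exists k, tau <= c ^+ k by exact: exprn_unbounded.
(* [M] is the logarithm of [tau] in base [c], rounded up; its minimality is what makes [C0 ^+ M]
   polynomial in [tau]. *)
have [M tauM Mmin] : exists2 M, tau <= c ^+ M & c ^+ M <= c * tau.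
  case: (ex_minnP exM) => M hM minM; exists M => //.
  case: M hM minM => [|M] hM minM; first by rewrite expr0; nra.
  rewrite exprS ler_pM2l // leNgt; apply/negP => /ltW /minM.
  by rewrite ltnn.
have [gu gV] := rep_unit g rep.
have [P [P0 P1 PD PT [Pexp Pbnd]]] := positive_powers gu.
(* With [u] lifting the [m]-th root of the Gram matrix, [u ^+ M.+1] lifts its square root: the
   factor 2 is the exponent of the polar decomposition. *)
pose m := (2 * M.+1)%N.
have SP t : S (P t).
  by apply: (algebraic_powers Sgrp) => //; rewrite P1; apply: SM => //; exact: ST.
have cM : c ^+ M <= c ^+ m.
  by apply: ler_weXn2l; rewrite ?ltW // (leq_trans (leqnSn M)) // leq_pmull.
have [u U0u uE] : exists2 u, U0 u & rho u = P m%:R^-1.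
  have : (S `&` V0) (P m%:R^-1).
    split=> //; apply: dV => i j; apply: le_lt_trans nc; apply: Pbnd => //.
    - exact: ltW.
    - by apply: le_trans cM; apply: le_trans tauM; rewrite /tau; lra.
    - rewrite mxtrace_mulC gV.
      by apply: le_trans cM; apply: le_trans tauM; rewrite /tau; lra.
  by rewrite -rhoU0 => -[u]; exists u.
have uX k : rho (u ^+ k)%g = P (k%:R * m%:R^-1).
  elim: k => [|k IH]; first by rewrite expg0 r1 mul0r P0.
  by rewrite expgS rM IH uE -PD -natr1 mulrDl mul1r addrC.
pose v := (u ^+ M.+1)%g.
have vE : rho v = P 2^-1.
  by rewrite /v uX /m natrM invfM mulrCA mulfV ?pnatr_eq0 // mulr1.
pose k := (g * v^-1)%g.
have vVE : rho (v^-1)%g = P (- 2^-1).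
  have [vu <-] := rep_unit v rep; rewrite vE.
  have e : P 2^-1 *m P (- 2^-1) = 1%:M by rewrite -PD subrr.
  by rewrite -[RHS](mulKmx (proj1 (rep_unit v rep))) vE e mulmx1.
have kO : (rho k)^T *m rho k = 1%:M.
  rewrite rM vVE trmx_mul PT -mulmxA (mulmxA _ (rho g)) -P1 -!PD.
  by rewrite -P0; congr P; field.
have -> : g = (k * v)%g by rewrite mulgVK.
apply: le_trans (sM _ _) _; rewrite -mulrA; apply: ler_pM; try exact/ltW.
  exact: KP.
apply: le_trans (scaleX _ _) _.
apply: (@le_trans _ _ (C0 ^+ M.+1)).
  by apply: lerXn2r; rewrite ?nnegrE ?(ltW C00) ?(ltW (s_gt0 _)) ?U0C.
(* Origin of the exponent: [C0 <= c ^+ d0'], while [c ^+ M.+1 <= c ^+ 2 * tau] by the choice of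
   [M]. *)
apply: (@le_trans _ _ ((c ^+ d0') ^+ M.+1)).
  by apply: lerXn2r; rewrite ?nnegrE ?(ltW C00) ?exprn_ge0 ?(ltW c0).
rewrite -exprM mulnC exprM -exprMn.
apply: lerXn2r; rewrite ?nnegrE ?exprn_ge0 ?(ltW c0) //; first by nra.
by rewrite exprS expr2 -mulrA ler_pM2l.
Qed.
End Scale.
End ReductiveScale.

(** * Unipotent groups of matrices *)

Section Kolchin.
Variable R : realType.
Local Open Scope complex_scope.
Import spectral.

Lemma trig_mulmx (K : comPzRingType) n (A B : 'M[K]_n) :
  is_trig_mx A -> is_trig_mx B ->
  is_trig_mx (A *m B) /\ forall i, (A *m B) i i = A i i * B i i.
Proof.
move=> /is_trig_mxP tA /is_trig_mxP tB; split=> [|i].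
  apply/is_trig_mxP => i j ij; rewrite mxE big1 // => k _.
  have [ik|ki] := ltnP i k; first by rewrite tA // mul0r.
  by rewrite [B k j]tB ?mulr0 // (leq_ltn_trans ki).
rewrite mxE (bigD1 i) //= big1 ?addr0 // => k ki.
have [ik|] := ltnP i k; first by rewrite tA // mul0r.
rewrite leq_eqVlt => /orP[/eqP/val_inj e|{}ki'].
  by rewrite e eqxx in ki.
by rewrite [B k i]tB // mulr0.
Qed.

(** The [lam i] are the diagonal entries of a Schur form [T]. Powers of a triangular matrix act
    entrywise on the diagonal, which gives traces and nilpotency; a fixed vector makes the
    triangular matrix [1 - T] singular, so one of its diagonal entries vanishes. *)
Lemma complex_eigenvalues n (M : 'M[R[i]]_n) : exists lam : 'I_n -> R[i],
  [/\ forall k, \tr (iter k (mulmx M) 1%:M) = \sum_i lam i ^+ k,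
      forall k, iter k (mulmx M) 1%:M = 0 -> forall i, lam i ^+ k = 0 &
      forall v : 'rV_n, v *m M = v -> v != 0 -> exists i, lam i = 1].
Proof.
case: n M => [|n] M.
  exists (fun=> 0); split=> [k|k _ []//|v _]; first by rewrite big_ord0 /mxtrace big_ord0.
  by rewrite [v]thinmx0 eqxx.
have [//|P Pu trigPM] := @Schur _ n.+1 M.
have Punit := unitarymx_unit Pu.
pose T := P *m M *m invmx P.
have trigT : is_trig_mx T.
  by move: trigPM; rewrite /similar_to conjumx.
have TX k : iter k (mulmx T) 1%:M = P *m iter k (mulmx M) 1%:M *m invmx P.
  elim: k => [|k IH] /=; first by rewrite mulmx1 mulmxV.
  by rewrite IH /T !mulmxA mulmxKV.
have Tk k : is_trig_mx (iter k (mulmx T) 1%:M) /\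
    forall i, (iter k (mulmx T) 1%:M) i i = T i i ^+ k.
  elim: k => [|k [t d]] /=.
    split=> [|i]; last by rewrite mxE eqxx.
    by apply/is_trig_mxP => i j ij; rewrite mxE; case: eqP ij => // ->; rewrite ltnn.
  have [t' d'] := trig_mulmx trigT t.
  by split=> // i; rewrite d' d exprS.
exists (fun i => T i i); split=> [k|k Mk0 i|v vM v0].
- have -> : \tr (iter k (mulmx M) 1%:M) = \tr (iter k (mulmx T) 1%:M).
    by rewrite TX -mulmxA mxtrace_mulC mulmxKV.
  by apply: eq_bigr => i _; case: (Tk k) => _ ->.
- by rewrite -(proj2 (Tk k)) TX Mk0 mulmx0 mul0mx mxE.
have : \det (1%:M - T) = 0.
  apply/eqP/det0P; exists (v *m invmx P).
    apply: contra v0 => /eqP /(congr1 (mulmx^~ P)).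
    by rewrite mulmxKV // mul0mx => ->.
  by rewrite mulmxBr mulmx1 /T !mulmxA mulmxKV // vM subrr.
rewrite det_trig; last first.
  apply/is_trig_mxP => i j ij; move/is_trig_mxP: trigT => /(_ i j ij) h.
  by rewrite mxE [(- T) i j]mxE h subr0 mxE; case: eqP ij => // ->; rewrite ltnn.
move=> /eqP/prodf_eq0 [i _]; rewrite mxE [(- T) i i]mxE mxE eqxx subr_eq0 => /eqP e.
by exists i.
Qed.

Lemma map_iter_mulmx n (M : 'M[R]_n) k :
  map_mx (real_complex R) (iter k (mulmx M) 1%:M) =
  iter k (mulmx (map_mx (real_complex R) M)) 1%:M.
Proof. by elim: k => [|k IH] /=; rewrite ?map_mx1 // map_mxM IH. Qed.

Lemma nilpotent_trace0 n (M : 'M[R]_n) k : iter k (mulmx M) 1%:M = 0 -> \tr M = 0.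
Proof.
move=> Mk; have [lam [tr0 nil _]] := complex_eigenvalues (map_mx (real_complex R) M).
have lam0 i : lam i = 0.
  apply/eqP; have := nil k; rewrite -map_iter_mulmx Mk map_mx0 => /(_ erefl i)/eqP.
  by rewrite expf_eq0 => /andP[].
have := tr0 1%N; rewrite /= mulmx1 trace_map_mx big1; last first.
  by move=> i _; rewrite lam0 expr1.
by move=> -[].
Qed.

(* Otherwise [1] is an eigenvalue; a polynomial without constant term that
   interpolates the indicator of [1] on the spectrum has a nonzero trace at [M]. *)
Lemma traceless_no_fixed n (M : 'M[R]_n) (v : 'rV_n) :
  (forall k, \tr (iter k.+1 (mulmx M) 1%:M) = 0) -> v *m M = v -> v = 0.
Proof.
move=> trM vM; apply/eqP; apply: contraT => v0.
have [lam [trE _ fix1]] := complex_eigenvalues (map_mx (real_complex R) M).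
have [||i0 lam1] := fix1 (map_mx (real_complex R) v).
- by rewrite -map_mxM vM.
- by rewrite map_mx_eq0.
have [p pE] := interpolation (0 :: [seq lam i | i : 'I_n])
  (fun x => if x == 1 then 1 else 0).
have lamk k : \sum_i lam i ^+ k.+1 = 0.
  by rewrite -trE -map_iter_mulmx trace_map_mx trM.
have p0 : p`_0 = 0.
  by rewrite -horner_coef0 pE ?mem_head // eq_sym oner_eq0.
have : \sum_i p.[lam i] = 0.
  under eq_bigr do rewrite horner_coef.
  rewrite exchange_big big1 //= => -[[|k] ?] _ /=.
    by under eq_bigr do rewrite p0 mul0r; rewrite big1.
  by rewrite -big_distrr /= lamk mulr0.
have memlam i : lam i \in 0 :: [seq lam i | i : 'I_n].
  by rewrite inE; apply/orP; right; apply/mapP; exists i; rewrite // mem_enum.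
rewrite (bigD1 i0) //= pE // lam1 eqxx => /eqP.
rewrite paddr_eq0 ?ler01 ?oner_eq0 //.
by apply: sumr_ge0 => i _; rewrite pE //; case: ifP.
Qed.

(** Among the matrices whose row space lies in [X], one of largest rank exhausts [X]: otherwise a
    further vector of [X] would raise the rank. *)
Lemma linear_set_mx (F : fieldType) n (X : set 'rV[F]_n) : X 0 ->
  (forall a u v, X u -> X v -> X (a *: u + v)) ->
  exists Y : 'M[F]_n, forall u, (u <= Y)%MS <-> X u.
Proof.
move=> X0 XL.
pose good r := `[< exists2 Y : 'M[F]_n, \rank Y = r & forall u : 'rV_n, (u <= Y)%MS -> X u >].
have ex : exists r, good r.
  exists 0%N; apply/asboolP; exists 0; first by rewrite mxrank0.
  by move=> u; rewrite submx0 => /eqP ->.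
have ub r : good r -> (r <= n)%N by move=> /asboolP[Y <- _]; exact: rank_leq_row.
case: (ex_maxnP ex ub) => r /asboolP[Y rY XY] max; exists Y => u; split; first exact: XY.
move=> Xu; have : (Y <= Y + u)%MS by exact: addsmxSl.
move=> /mxrank_leqif_eq [le1 eqY].
have : good (\rank (Y + u)%MS).
  apply/asboolP; exists (Y + u)%MS => // w /sub_addsmxP[[a b] /= ->].
  have -> : b *m u = b 0 0 *: u by rewrite {1}[b]mx11_scalar mul_scalar_mx.
  by rewrite addrC; apply: XL => //; apply: XY; exact: submxMl.
move=> /max; rewrite -rY => le2.
have : (\rank Y == \rank (Y + u)%MS) by rewrite eqn_leq le1 le2.
by rewrite eqY => /eqmxP ->; exact: addsmxSr.
Qed.

(* If [w] is in [w A], then [w] is fixed by an element of [A]; hence [w A] has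
   smaller dimension than a stable subspace containing a nonzero [w]. *)
Lemma nilpotent_algebra (F : fieldType) n (A : set 'M[F]_n) :
  A 0 -> (forall c a b, A a -> A b -> A (c *: a + b)) ->
  (forall a b, A a -> A b -> A (a *m b)) ->
  (forall a (v : 'rV_n), A a -> v *m a = v -> v = 0) ->
  exists D, forall l : seq 'M[F]_n, (D <= size l)%N -> (forall a, a \in l -> A a) ->
    foldr mulmx 1%:M l = 0.
Proof.
move=> A0 AL AM fixA.
have main r : forall W : 'M[F]_n, (\rank W <= r)%N ->
    (forall a, A a -> (W *m a <= W)%MS) ->
    exists D, forall l, (D <= size l)%N -> (forall a, a \in l -> A a) ->
      W *m foldr mulmx 1%:M l = 0.
  elim: r => [|r IH] W rW WA.
    exists 0%N => l _ _; move: rW; rewrite leqn0 mxrank_eq0 => /eqP ->.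
    by rewrite mul0mx.
  have rowD i : exists D, forall l, (D <= size l)%N -> (forall a, a \in l -> A a) ->
      row i W *m foldr mulmx 1%:M l = 0.
    have [w0|w0] := eqVneq (row i W) 0; first by exists 0%N => l _ _; rewrite w0 mul0mx.
    have [||Y YP] := @linear_set_mx _ _ [set u | exists2 a, A a & u = row i W *m a].
    - by exists 0; rewrite ?mulmx0.
    - move=> c _ _ [a Aa ->] [b Ab ->]; exists (c *: a + b); first exact: AL.
      by rewrite mulmxDr scalemxAr.
    have YA a : A a -> (Y *m a <= Y)%MS.
      move=> Aa; apply/row_subP => j; rewrite row_mul; apply/YP.
      have /YP[b Ab ->] := row_sub j Y.
      by exists (b *m a); [exact: AM|rewrite mulmxA].
    have YW : (Y <= W)%MS.
      apply/row_subP => j; have /YP[b Ab ->] := row_sub j Y.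
      by apply: submx_trans (WA b Ab); rewrite submxMr // row_sub.
    have rY : (\rank Y <= r)%N.
      rewrite -ltnS; apply: leq_trans rW; have [le1 eqY] := mxrank_leqif_eq YW.
      rewrite ltn_neqAle le1 andbT eqY; apply: contra w0 => /eqmxP YeW.
      have /YP[a Aa /esym wa] : (row i W <= Y)%MS by rewrite YeW row_sub.
      by apply/eqP; exact: fixA wa.
    have [D DP] := IH Y rY YA; exists D.+1 => -[//|a l] /= sl lA.
    have /YP/submxP[z zE] : exists2 b, A b & row i W *m a = row i W *m b.
      by exists a => //; apply: lA; rewrite mem_head.
    rewrite mulmxA zE -mulmxA DP ?mulmx0 // => b bl.
    by apply: lA; rewrite inE bl orbT.
  have [D DP] := boolp.choice rowD.
  exists (\max_i D i) => l sl lA; apply/row_matrixP => i; rewrite row_mul row0.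
  by apply: DP => //; apply: leq_trans sl; exact: leq_bigmax.
have [D DP] := main n 1%:M (rank_leq_row _) (fun a _ => submx1 _).
by exists D => l sl lA; rewrite -[LHS]mul1mx DP.
Qed.

(* The span of the [u - 1] is an algebra of traceless matrices. *)
Lemma kolchin n (H : set 'M[R]_n) : H 1%:M ->
  (forall a b, H a -> H b -> H (a *m b)) -> (forall a, H a -> unipotent a) ->
  exists D, forall l : seq 'M[R]_n, (D <= size l)%N -> (forall a, a \in l -> H a) ->
    foldr (fun a M => (a - 1%:M) *m M) 1%:M l = 0.
Proof.
move=> H1 HM Hu; pose E := [set a - 1%:M | a in H].
have iterE (M : 'M[R]_n) k : M ^+ k = iter k (mulmx M) 1%:M.
  by elim: k => [|k IH] //=; rewrite exprS IH.
have [L0 LL] := lspan_submod E.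
have LE e : E e -> lspan E e.
  move=> Ee; exists 1%N, (fun=> 1), (fun=> e); split=> //.
  by rewrite big_ord1 scale1r.
have EM a b : E a -> E b -> lspan E (a *m b).
  move=> [x Hx <-] [y Hy <-].
  have -> : (x - 1%:M) *m (y - 1%:M) =
      -1 *: (x - 1%:M) + (-1 *: (y - 1%:M) + (x *m y - 1%:M)).
    rewrite mulmxBr mulmx1 mulmxBl mul1mx !scaleN1r.
    by set z := x *m y; apply/matrixP => i j; rewrite !mxE; ring.
  apply: (LL); first by apply: LE; exists x.
  apply: (LL); first by apply: LE; exists y.
  by apply: LE; exists (x *m y) => //; exact: HM.
have LM a b : lspan E a -> lspan E b -> lspan E (a *m b).
  have Lsum m (c : 'I_m -> R) (x : 'I_m -> 'M_n) : (forall i, lspan E (x i)) ->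
      lspan E (\sum_i c i *: x i).
    move=> Lx; elim/big_rec : _ => // i y _ Ly; exact: LL.
  move=> [m [c [x [Ex ->]]]] [p [d [y [Ey ->]]]].
  rewrite mulmx_suml; under eq_bigr do rewrite -scalemxAl.
  apply: (Lsum) => i; rewrite mulmx_sumr; under eq_bigr do rewrite -scalemxAr.
  by apply: Lsum => j; exact: EM.
have trE e : lspan E e -> \tr e = 0.
  move=> [m [c [x [Ex ->]]]]; rewrite raddf_sum /= big1 // => i _.
  rewrite mxtraceZ; have [a Ha <-] := Ex i; have [k ak] := Hu a Ha.
  by rewrite (@nilpotent_trace0 _ _ k) ?mulr0 // -iterE.
have [|D DP] := nilpotent_algebra L0 LL LM.
  move=> a v La; apply: traceless_no_fixed => k; apply: trE.
  by elim: k => [|k IH] /=; [rewrite mulmx1|exact: LM].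
exists D => l sl lH; rewrite -(DP [seq a - 1%:M | a <- l]) ?size_map //.
  by rewrite foldr_map.
by move=> _ /mapP[a al ->]; apply: LE; exists a => //; exact: lH.
Qed.
End Kolchin.

(** * Polynomial growth of products of powers of unipotent matrices *)

Section Growth.
Variable R : realType.

Definition norm1 m n (A : 'M[R]_(m, n)) : R := \sum_i \sum_j `|A i j|.

Lemma norm1_ge0 m n (A : 'M[R]_(m, n)) : 0 <= norm1 A.
Proof. by apply: sumr_ge0 => i _; apply: sumr_ge0. Qed.

Lemma norm1D m n (A B : 'M[R]_(m, n)) : norm1 (A + B) <= norm1 A + norm1 B.
Proof.
rewrite -big_split /=; apply: ler_sum => i _; rewrite -big_split /=.
by apply: ler_sum => j _; rewrite mxE ler_normD.
Qed.

Lemma norm1M m n p (A : 'M[R]_(m, n)) (B : 'M[R]_(n, p)) :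
  norm1 (A *m B) <= norm1 A * norm1 B.
Proof.
rewrite big_distrl /=; apply: ler_sum => i _.
apply: (@le_trans _ _ (\sum_j \sum_k `|A i k| * `|B k j|)).
  apply: ler_sum => j _; rewrite mxE; apply: le_trans (ler_norm_sum _ _ _) _.
  by apply: ler_sum => k _; rewrite normrM.
rewrite exchange_big big_distrl /=; apply: ler_sum => k _.
rewrite -big_distrr /=; apply: ler_wpM2l => //.
rewrite [leRHS](bigD1 k) //= lerDl; apply: sumr_ge0 => l _.
by apply: sumr_ge0.
Qed.

Lemma gram_le_norm1 n (A : 'M[R]_n) : \tr (A^T *m A) <= norm1 A ^+ 2.
Proof.
rewrite expr2 {1}/norm1 exchange_big big_distrl /=; apply: ler_sum => i _.
rewrite mxE big_distrl /=; apply: ler_sum => j _.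
rewrite mxE; apply: le_trans (ler_norm _) _; rewrite normrM ler_wpM2l //.
rewrite /norm1 (bigD1 j) //= (bigD1 i) //= -addrA lerDl.
by apply: addr_ge0; apply: sumr_ge0 => // k _; apply: sumr_ge0.
Qed.

(** In [k], the sequence [(u - 1) ^+ (D - e.+1) * u ^+ k] has increments
    [(u - 1) ^+ (D - e) * u ^+ k]; summing them raises the degree of the bound by one at each step
    of the induction on [e]. *)
Lemma unipotent_power_growth n (u : 'M[R]_n) D : (u - 1%:M) ^+ D = 0 ->
  exists2 C, 0 <= C & forall k, norm1 (u ^+ k) <= C * k.+1%:R ^+ D.
Proof.
move=> uD.
have main e : (e <= D)%N -> exists2 C, 0 <= C &
    forall k, norm1 ((u - 1%:M) ^+ (D - e) * u ^+ k) <= C * k.+1%:R ^+ e.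
  elim: e => [|e IH] eD.
    exists 0 => // k; rewrite subn0 uD mul0r mul0r /norm1 big1 // => i _.
    by rewrite big1 // => j _; rewrite mxE normr0.
  have [C C0 CP] := IH (ltnW eD).
  set M := (u - 1%:M) ^+ (D - e.+1).
  have MS k : M * u ^+ k.+1 = (u - 1%:M) ^+ (D - e) * u ^+ k + M * u ^+ k.
    rewrite (_ : (D - e)%N = (D - e.+1).+1); last by rewrite subnSK.
    rewrite exprS [X in X * _ + _]exprSr -/M -mulrA -mulrDr mulrBl.
    have -> : 1%:M * u ^+ k = u ^+ k by exact: mul1mx.
    by rewrite subrK.
  exists (norm1 M + C) => [|k]; first by rewrite addr_ge0 ?norm1_ge0.
  have h0 : 0 <= norm1 M by exact: norm1_ge0.
  elim: k => [|k IHk]; first by rewrite expr0 mulr1 expr1n mulr1 lerDl.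
  rewrite MS; apply: le_trans (norm1D _ _) _; apply: le_trans (lerD (CP k) IHk) _.
  have a0 : 0 <= (k.+1%:R : R) ^+ e by rewrite exprn_ge0.
  have le1 : (k.+1%:R : R) ^+ e <= k.+2%:R ^+ e by apply: lerXn2r; rewrite ?nnegrE // ler_nat.
  have : (k.+1%:R : R) ^+ e.+1 + k.+1%:R ^+ e <= k.+2%:R ^+ e.+1.
    have e2 : (k.+2%:R : R) = k.+1%:R + 1 by rewrite natr1.
    have k0 : 0 <= (k.+1%:R : R) by [].
    rewrite e2 in le1 *.
    by rewrite !exprS; nra.
  nra.
have [C C0 CP] := main D (leqnn _); exists C => // k.
by have := CP k; rewrite subnn expr0 mul1r.
Qed.

(** Each [u ^+ k] is expanded as [1 + (u ^+ k - 1)]. Products of [D] or more differences vanish, and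
    each remaining factor has degree at most [D] in [k], so the degree [D * D] serves every [l];
    only the constant depends on the list. *)
Lemma unipotent_growth n (H : set 'M[R]_n) : H 1%:M ->
  (forall a b, H a -> H b -> H (a *m b)) -> (forall a, H a -> unipotent a) ->
  exists E, forall l : seq 'M[R]_n, (forall a, a \in l -> H a) ->
    exists2 C, 0 <= C & forall k,
      norm1 (foldr (fun u M => u ^+ k *m M) 1%:M l) <= C * k.+1%:R ^+ E.
Proof.
move=> H1 HM Hu; have [D DP] := kolchin H1 HM Hu.
have HX u k : H u -> H (u ^+ k).
  by move=> Hu'; elim: k => [|k IH]; [rewrite expr0|rewrite exprS; exact: HM].
have uD u : H u -> (u - 1%:M) ^+ D = 0.
  move=> Hu'; have := DP (nseq D u); rewrite size_nseq leqnn => /(_ isT).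
  move=> <-; last by move=> a; rewrite mem_nseq => /andP[_ /eqP ->].
  by elim: (D) => [|k IH] //=; rewrite exprS IH.
pose pw k (l : seq 'M[R]_n) := foldr (fun u M => u ^+ k *m M) 1%:M l.
pose df k (l : seq 'M[R]_n) := foldr (fun u M => (u ^+ k - 1%:M) *m M) 1%:M l.
have k1 (k : nat) : 1 <= k.+1%:R :> R by rewrite ler1n.
have dfb (l : seq 'M[R]_n) : (forall a, a \in l -> H a) ->
    exists2 C, 0 <= C & forall k, norm1 (df k l) <= C * k.+1%:R ^+ (D * size l).
  elim: l => [|u l IH] lH /=.
    exists (norm1 (1%:M : 'M[R]_n)); first exact: norm1_ge0.
    by move=> k; rewrite muln0 expr0 mulr1.
  have [|C C0 CP] := IH; first by move=> a al; apply: lH; rewrite inE al orbT.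
  have [|C' C'0 CP'] := @unipotent_power_growth n u D.
    by apply: uD; apply: lH; rewrite mem_head.
  exists ((C' + norm1 (- 1%:M : 'M[R]_n)) * C).
    by rewrite mulr_ge0 // addr_ge0 // norm1_ge0.
  move=> k; apply: le_trans (norm1M _ _) _.
  rewrite mulnS exprD mulrACA; apply: ler_pM; rewrite ?norm1_ge0 //.
  apply: le_trans (norm1D _ _) _; rewrite mulrDl lerD //.
  by rewrite ler_peMr ?norm1_ge0 // exprn_ege1.
exists (D * D)%N => r rH.
suff [C C0 CP] : exists2 C, 0 <= C & forall k,
    norm1 (df k [::] *m pw k r) <= C * k.+1%:R ^+ (D * D).
  by exists C => // k; have := CP k; rewrite /df /= mul1mx.
have : forall a, a \in [::] -> H a by [].
(* The accumulator holds the differences already chosen: expanding the head [u] of [r] either drops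
   it or appends [u ^+ k - 1] to [l], and the expansion stops once [l] has length [D]. *)
elim: r [::] rH => [|u r IH] l rH lH.
  have [Dl|lD] := leqP D (size l).
    exists 0 => // k; rewrite mul0r.
    suff -> : df k l = 0.
      by rewrite mul0mx /norm1 big1 // => i _; rewrite big1 // => j _; rewrite mxE normr0.
    have := DP [seq u ^+ k | u <- l]; rewrite size_map foldr_map; apply=> //.
    by move=> _ /mapP[a al ->]; apply: HX; exact: lH.
  have [C C0 CP] := dfb l lH; exists C => // k; rewrite /pw /= mulmx1.
  apply: le_trans (CP k) _; rewrite ler_wpM2l // ler_weXn2l // leq_mul2l ltnW ?orbT //.
have rH' a : a \in r -> H a by move=> ar; apply: rH; rewrite inE ar orbT.
have [C C0 CP] := IH l rH' lH.
have [|C' C'0 CP'] := IH (rcons l u) rH'.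
  move=> a; rewrite mem_rcons inE => /orP[/eqP ->|]; last exact: lH.
  by apply: rH; rewrite mem_head.
exists (C + C'); first exact: addr_ge0.
move=> k; rewrite mulrDl; apply: le_trans (lerD (CP k) (CP' k)).
apply: le_trans (norm1D _ _); rewrite le_eqVlt; apply/orP; left; apply/eqP.
congr norm1.
have -> : df k (rcons l u) = df k l *m (u ^+ k - 1%:M).
  rewrite /df; elim: (l) => [|a l' IHl] /=; first by rewrite mulmx1 mul1mx.
  by rewrite IHl mulmxA.
rewrite -mulmxA -mulmxDr mulmxBl mul1mx addrC subrK.
by [].
Qed.
End Growth.

(** * Seminorms on locally convex spaces *)

Section Seminorms.
Variable R : realType.
Local Open Scope complex_scope.

Definition cmod (z : R[i]) : R := complex.Re `|z|.

Lemma cmodE z : `|z| = (cmod z)%:C.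
Proof. by rewrite /cmod normc_def. Qed.

Lemma cmod_ge0 z : 0 <= cmod z.
Proof. by rewrite /cmod normc_def /= sqrtr_ge0. Qed.

Lemma cmodM z w : cmod (z * w) = cmod z * cmod w.
Proof.
have : (cmod (z * w))%:C = (cmod z * cmod w)%:C.
  by rewrite rmorphM /= -!cmodE normrM.
by case.
Qed.

Lemma cmod_real (x : R) : cmod x%:C = `|x|.
Proof. by rewrite /cmod normc_def /= expr0n addr0 sqrtr_sqr. Qed.

Lemma cmod_eq0 z : (cmod z == 0) = (z == 0).
Proof.
apply/eqP/eqP => [c0|->]; last by rewrite /cmod normr0.
by apply/eqP; rewrite -normr_eq0 cmodE c0.
Qed.

Lemma cmodV z : cmod z^-1 = (cmod z)^-1.
Proof.
have : (cmod z^-1)%:C = ((cmod z)^-1)%:C by rewrite fmorphV /= -!cmodE normfV.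
by case.
Qed.

Section Algebra.
Variables (V : lmodType R[i]) (p : V -> R).
Hypothesis sp : seminorm p.

Lemma seminormD v w : p (v + w) <= p v + p w. Proof. by case: sp => + _; exact. Qed.

Lemma seminormZ a v : p (a *: v) = cmod a * p v.
Proof. by case: sp => _; exact. Qed.

Lemma seminormZr (x : R) v : p (x%:C *: v) = `|x| * p v.
Proof. by rewrite seminormZ cmod_real. Qed.

Lemma seminorm0 : p 0 = 0.
Proof. by rewrite -(scale0r (0 : V)) seminormZ /cmod normr0 mul0r. Qed.

Lemma seminormN v : p (- v) = p v.
Proof. by rewrite -scaleN1r seminormZ /cmod normrN1 mul1r. Qed.

Lemma seminorm_distC v w : p (v - w) = p (w - v).
Proof. by rewrite -seminormN opprB. Qed.

Lemma seminorm_ge0 v : 0 <= p v.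
Proof.
have := seminormD v (- v); rewrite subrr seminorm0 seminormN; lra.
Qed.

Lemma seminormB v w : p (v - w) <= p v + p w.
Proof. by rewrite -[p w]seminormN; exact: seminormD. Qed.

Lemma seminorm_dist v w : `|p v - p w| <= p (v - w).
Proof.
have := seminormD (v - w) w; have := seminormD (w - v) v.
rewrite !subrK (seminorm_distC w) => h1 h2; rewrite ler_norml; lra.
Qed.

Lemma seminorm_sum (I : Type) (r : seq I) (f : I -> V) :
  p (\sum_(i <- r) f i) <= \sum_(i <- r) p (f i).
Proof.
elim: r => [|i r IH]; first by rewrite !big_nil seminorm0.
by rewrite !big_cons; apply: le_trans (seminormD _ _) _; rewrite lerD2l.
Qed.

Lemma seminorm_lspan0 (S : set V) :
  (forall v, S v -> p v = 0) -> forall v, lspan S v -> p v = 0.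
Proof.
move=> pS _ [m [c [x [Sx ->]]]]; apply/eqP; rewrite eq_le seminorm_ge0 andbT.
apply: le_trans (seminorm_sum _ _) _; rewrite big1 // => i _.
by rewrite seminormZ pS // mulr0.
Qed.

End Algebra.

Section Dist.
Variables (V : lmodType R[i]) (p : V -> R) (W : set V).
Hypotheses (sp : seminorm p) (W0 : W 0).
Hypothesis WL : forall a x y, W x -> W y -> W (a *: x + y).

(** The quotient seminorm of [p] modulo [W], pulled back to [V]. It is dominated by [p], hence
    continuous when [p] is, and its vanishing at [v] means that [W] approximates [v] for [p]. *)
Definition dist_seminorm (v : V) : R := inf [set p (v + w) | w in W].

Lemma dist_lb v : has_lbound [set p (v + w) | w in W].
Proof. by exists 0 => _ [w _ <-]; exact: seminorm_ge0. Qed.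

Lemma dist_le v w : W w -> dist_seminorm v <= p (v + w).
Proof. by move=> Ww; apply: ge_inf; [exact: dist_lb|exists w]. Qed.

Lemma dist_lt v e : dist_seminorm v < e -> exists2 w, W w & p (v + w) < e.
Proof.
move=> /inf_lt[|_ [w Ww <-] h]; first by exists (p (v + 0)), 0.
by exists w.
Qed.

Lemma dist_le_seminorm v : dist_seminorm v <= p v.
Proof. by rewrite -{2}[v]addr0; exact: dist_le. Qed.

Lemma dist_ge0 v : 0 <= dist_seminorm v.
Proof.
apply: lb_le_inf; first by exists (p (v + 0)), 0.
by move=> _ [w _ <-]; exact: seminorm_ge0.
Qed.

Lemma dist_zero w : W w -> dist_seminorm w = 0.
Proof.
move=> Ww; apply/eqP; rewrite eq_le dist_ge0 andbT -(seminorm0 sp) -(subrr w).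
by apply: dist_le; rewrite -scaleN1r -[_ *: _]addr0; exact: WL.
Qed.

Lemma dist_seminormP : seminorm dist_seminorm.
Proof.
have hom a v : dist_seminorm (a *: v) <= cmod a * dist_seminorm v.
  have [->|a0] := eqVneq a 0.
    by rewrite scale0r dist_zero // mulr_ge0 ?cmod_ge0 ?dist_ge0.
  have ca : 0 < cmod a by rewrite lt_neqAle eq_sym cmod_eq0 a0 cmod_ge0.
  apply/ler_addgt0Pr => e e0.
  have [|w Ww h] := @dist_lt v (dist_seminorm v + e / cmod a).
    by rewrite ltrDl divr_gt0.
  apply: (@le_trans _ _ (p (a *: v + a *: w))).
    by apply: dist_le; rewrite -[_ *: _]addr0; exact: WL.
  rewrite -scalerDr seminormZ //; apply: le_trans (ler_wpM2l (ltW ca) (ltW h)) _.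
  by rewrite mulrDr mulrCA divff ?mulr1 // gt_eqF.
split=> [v w|a v].
  apply/ler_addgt0Pr => e e0.
  have [|x Wx hx] := @dist_lt v (dist_seminorm v + e / 2); first by rewrite ltrDl divr_gt0.
  have [|y Wy hy] := @dist_lt w (dist_seminorm w + e / 2); first by rewrite ltrDl divr_gt0.
  apply: (@le_trans _ _ (p ((v + w) + (1 *: x + y)))); first by apply: dist_le; exact: WL.
  rewrite scale1r addrACA; apply: le_trans (seminormD sp _ _) _; lra.
apply/eqP; rewrite eq_le hom andTb -/(cmod a).
have [->|a0] := eqVneq a 0.
  by rewrite scale0r /cmod normr0 mul0r dist_zero.
have ca : 0 < cmod a by rewrite lt_neqAle eq_sym cmod_eq0 a0 cmod_ge0.
have := hom a^-1 (a *: v); rewrite scalerA mulVf // scale1r cmodV.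
by rewrite mulrC ler_pdivlMr // mulrC.
Qed.

End Dist.

Section Topology.
Variable V : topologicalLmodType R[i].

Lemma nbhs_translate (x : V) A : nbhs x A <-> nbhs 0 [set y | A (x + y)].
Proof.
have tr (a b : V) B : nbhs (a + b) B -> nbhs b [set y | B (a + y)].
  move=> nB; apply: (@continuous_comp V (V * V)%type V (fun y => (a, y))
    (fun z => z.1 + z.2)); last exact: nB.
    by apply: cvg_pair; [exact: cvg_cst|exact: cvg_id].
  exact: add_continuous.
split=> [nA|nA]; first by apply: tr; rewrite addr0.
have := tr (- x) x [set y | A (x + y)]; rewrite addNr => /(_ nA).
by apply: filterS => y /=; rewrite addNKr.
Qed.

Lemma scale_cst_continuous (a : R[i]) : continuous (fun v : V => a *: v).
Proof.
move=> z; apply: (@continuous_comp V (R[i]^o * V)%type V (fun z => (a, z))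
    (fun z => z.1 *: z.2)); last exact: scale_continuous.
by apply: (@cvg_pair _ _ _ _ (nbhs (a : R[i]^o))); [exact: cvg_cst|exact: cvg_id].
Qed.

Lemma nbhs0_scale (a : R[i]) (U : set V) : nbhs 0 U -> nbhs 0 [set v | U (a *: v)].
Proof.
by move=> nU; apply: (@scale_cst_continuous a 0 U); rewrite scaler0.
Qed.

Lemma seminorm_continuous (p : V -> R) : seminorm p ->
  nbhs 0 [set v | p v < 1] -> continuous p.
Proof.
move=> sp n1 x; apply/cvgrPdist_lt => e e0.
apply/nbhs_translate; have := nbhs0_scale ((e^-1)%:C) n1.
apply: filterS => y /=; rewrite seminormZr // ger0_norm ?invr_ge0 ?ltW //.
rewrite ltr_pdivrMl // mulr1 => h.
apply: le_lt_trans (seminorm_dist sp _ _) _.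
by rewrite opprD addrA subrr add0r seminormN.
Qed.

Lemma continuous_seminorm_ball (p : V -> R) (x : V) e :
  continuous_seminorm p -> 0 < e -> nbhs x [set y | p (y - x) < e].
Proof.
move=> [sp cp] e0; apply/nbhs_translate.
have := cp 0; rewrite /continuous_at seminorm0 // => /cvgrPdist_lt/(_ e e0).
apply: filterS => y /=; rewrite sub0r normrN ger0_norm ?seminorm_ge0 //.
by rewrite addrAC subrr add0r.
Qed.

Lemma dominated_seminorm_continuous (p q : V -> R) :
  continuous_seminorm p -> seminorm q -> (forall v, q v <= p v) ->
  continuous_seminorm q.
Proof.
move=> cp sq qp; split=> //; apply: seminorm_continuous => //.
have := continuous_seminorm_ball 0 cp ltr01.
by apply: filterS => y /=; rewrite subr0; exact: le_lt_trans.
Qed.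

Lemma continuous_seminorm_sum (n : nat) (p : nat -> V -> R) :
  (forall i, continuous_seminorm (p i)) ->
  continuous_seminorm (fun v => \sum_(i < n) p i v).
Proof.
move=> cp; split; last first.
  elim: n => [|n IH]; first by under eq_fun do rewrite big_ord0; exact: cst_continuous.
  under eq_fun do rewrite big_ord_recr /=; move=> v.
  by apply: cvgD; [exact: IH|case: (cp n) => _; exact].
split=> [v w|a v].
  by rewrite -big_split /=; apply: ler_sum => i _; exact: (seminormD (cp i).1).
by rewrite big_distrr /=; apply: eq_bigr => i _; exact: (seminormZ (cp i).1).
Qed.

Lemma seminorm_closure0 (p : V -> R) (S : set V) : continuous_seminorm p ->
  (forall v, S v -> p v = 0) -> forall v, closure S v -> p v = 0.
Proof.
move=> cp pS v clv; have sp := cp.1; apply/eqP; rewrite eq_le seminorm_ge0 // andbT.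
apply/ler_addgt0Pr => e e0; rewrite add0r.
have [w [/pS pw /= h]] := clv _ (continuous_seminorm_ball v cp e0).
rewrite -[v](subrK w); apply: le_trans (seminormD sp _ _) _.
by rewrite pw addr0 seminorm_distC // ltW.
Qed.

End Topology.

Section LocallyConvex.
Variable V : tvsType R[i].

Lemma convex_nbhs (U : set V) : nbhs 0 U ->
  exists b : set V, [/\ nbhs 0 b, b `<=` U & forall v w (l : R), b v -> b w ->
    0 <= l -> l <= 1 -> b (l%:C *: v + (1 - l)%:C *: w)].
Proof.
move=> nU; have [B cB [Bopen Bbase]] := @locally_convex _ V.
have [b [Bb b0] bU] := Bbase 0 U nU.
exists b; split=> //; first by apply: open_nbhs_nbhs; split => //; exact: Bopen.
move=> v w l bv bw l0 l1.
have l0' : 0 <= l%:C by rewrite lecR.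
have l1' : l%:C <= 1 by rewrite lecR.
have := cB b (mem_set Bb) v w (Itv01 l0' l1') (mem_set bv) (mem_set bw).
move=> /set_mem; congr b; congr (_ + _ *: _).
by rewrite /= rmorphB.
Qed.

(** The balanced core of a convex neighbourhood. It is a neighbourhood by continuity of scaling at
    the origin: a disc of radius [dr] times [B2] lies in [b], and [z *: v] is [z * (dr / 2)] times
    [(2 / dr) *: v]. *)
Lemma absolutely_convex_nbhs (U : set V) : nbhs 0 U ->
  exists b : set V, [/\ nbhs 0 b, b `<=` U,
    forall v w (l : R), b v -> b w -> 0 <= l -> l <= 1 ->
      b (l%:C *: v + (1 - l)%:C *: w) &
    forall (z : R[i]) v, cmod z <= 1 -> b v -> b (z *: v)].
Proof.
move=> /convex_nbhs [b [nb bU bc]].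
exists [set v | forall z, cmod z <= 1 -> b (z *: v)]; split.
- have := @scale_continuous _ V ((0 : R[i]^o), (0 : V)) b; rewrite /= scaler0.
  move=> /(_ nb) [[B1 B2] /= [nB1 nB2] sB].
  have [d d0 dB] : exists2 d : R, 0 < d & forall z, cmod z < d -> B1 z.
    have /nbhs_ballP [d /= d0 sub] := nB1.
    have [dr dE] : exists dr : R, d = dr%:C.
      by exists (complex.Re d); have /complex_realP[x ->] := gtr0_real d0.
    rewrite dE in d0 sub; exists dr; first by rewrite -ltcR.
    move=> z zd; apply: sub; rewrite -ball_normE /= sub0r normrN cmodE.
    by rewrite ltcR.
  have := nbhs0_scale ((2 / d)%:C) nB2; apply: filterS => v /= B2v z z1.
  have -> : z *: v = (z * (d / 2)%:C) *: ((2 / d)%:C *: v).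
    rewrite scalerA -mulrA -rmorphM /=.
    have -> : d / 2 * (2 / d) = 1 by field; rewrite gt_eqF.
    by rewrite mulr1.
  apply: (sB (z * (d / 2)%:C, (2 / d)%:C *: v)); split=> //=; apply: dB.
  have := cmod_ge0 z.
  rewrite cmodM cmod_real ger0_norm ?divr_ge0 ?(ltW d0) // => h; nra.
- by move=> v /(_ 1); rewrite scale1r /cmod normr1 => /(_ (lexx _)) /bU.
- move=> v w l bv bw l0 l1 z z1; rewrite scalerDr !scalerA ![z * _]mulrC -!scalerA.
  by apply: bc => //; [exact: bv|exact: bw].
- move=> z v z1 bv w w1; rewrite scalerA; apply: bv.
  by rewrite cmodM mulr_ile1 ?cmod_ge0.
Qed.

Lemma minkowski (U : set V) : nbhs 0 U ->
  exists2 p : V -> R, continuous_seminorm p & forall v, p v < 1 -> U v.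
Proof.
move=> /absolutely_convex_nbhs [b [nb bU bc bz]].
have b0 : b 0 by exact: nbhs_singleton.
pose T v := [set t : R | 0 < t /\ b ((t^-1)%:C *: v)].
pose p v := inf (T v).
have lbT v : has_lbound (T v) by exists 0 => t [/ltW].
have absorb v : T v !=set0.
  have := @scale_continuous _ V ((0 : R[i]^o), v) b; rewrite /= scale0r.
  move=> /(_ nb) [[B1 B2] /= [nB1 nB2] sB].
  have /nbhs_ballP [d /= d0 sub] := nB1.
  have [dr dE] : exists dr : R, d = dr%:C.
    by exists (complex.Re d); have /complex_realP[x ->] := gtr0_real d0.
  rewrite dE in d0 sub; rewrite ltcR in d0.
  exists (2 / dr); split; first by rewrite divr_gt0.
  apply: (sB (((2 / dr)^-1)%:C, v)); split; last exact: nbhs_singleton.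
  apply: sub; rewrite -ball_normE /= sub0r normrN cmodE cmod_real ltcR.
  rewrite ger0_norm ?invr_ge0 ?divr_ge0 ?ltW // invf_div; lra.
have p_ge0 v : 0 <= p v by apply: lb_le_inf => // t [/ltW].
have Tle v t : T v t -> p v <= t by exact: ge_inf.
have star v s t : T v s -> s <= t -> T v t.
  move=> [s0 bs] st; have t0 : 0 < t by exact: lt_le_trans st.
  split=> //; have -> : (t^-1)%:C *: v = (s / t)%:C *: ((s^-1)%:C *: v).
    rewrite scalerA -rmorphM /=; congr (_%:C *: _).
    by field; rewrite !gt_eqF.
  apply: bz => //; rewrite cmod_real ger0_norm ?divr_ge0 ?(ltW s0) ?(ltW t0) //.
  by rewrite ler_pdivrMr // mul1r.
have Tlt v t : p v < t -> T v t.
  by move=> /inf_lt[//|s Ts /ltW]; exact: star.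
have pD v w : p (v + w) <= p v + p w.
  apply/ler_addgt0Pr => e e0.
  have [s0 bs] : T v (p v + e / 2) by apply: Tlt; rewrite ltrDl divr_gt0.
  have [t0 bt] : T w (p w + e / 2) by apply: Tlt; rewrite ltrDl divr_gt0.
  have -> : p v + p w + e = (p v + e / 2) + (p w + e / 2) by field.
  move: (p v + _) (p w + _) s0 t0 bs bt => s t s0 t0 bs bt.
  apply: Tle; split; first exact: addr_gt0.
  have st0 : s + t != 0 by rewrite gt_eqF // addr_gt0.
  have := bc _ _ (s / (s + t)) bs bt; rewrite !scalerA -!rmorphM /=.
  have -> : s / (s + t) * s^-1 = (s + t)^-1 by field; rewrite st0 gt_eqF.
  have -> : (1 - s / (s + t)) * t^-1 = (s + t)^-1 by field; rewrite st0 gt_eqF.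
  rewrite -scalerDr; apply; first by rewrite divr_ge0 // ltW // addr_gt0.
  by rewrite ler_pdivrMr ?addr_gt0 // mul1r lerDl ltW.
have hom a v : p (a *: v) <= cmod a * p v.
  apply/ler_addgt0Pr => e e0.
  have [->|a0] := eqVneq a 0.
    rewrite /cmod normr0 mul0r add0r scale0r; apply: Tle.
    by split => //; rewrite scaler0.
  have ca : 0 < cmod a by rewrite lt_neqAle eq_sym cmod_eq0 a0 cmod_ge0.
  have [s0 bs] : T v (p v + e / cmod a) by apply: Tlt; rewrite ltrDl divr_gt0.
  have -> : cmod a * p v + e = cmod a * (p v + e / cmod a).
    by rewrite mulrDr mulrCA divff ?mulr1 // gt_eqF.
  move: (p v + _) s0 bs => s s0 bs.
  apply: Tle; split; first exact: mulr_gt0.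
  have -> : ((cmod a * s)^-1)%:C *: (a *: v) =
            (((cmod a)^-1)%:C * a) *: ((s^-1)%:C *: v).
    rewrite !scalerA; congr (_ *: _); rewrite invfM rmorphM /=; ring.
  apply: bz => //; rewrite cmodM cmod_real ger0_norm ?invr_ge0 ?cmod_ge0 //.
  by rewrite mulVf // gt_eqF.
have sp : seminorm p.
  split=> // a v; apply/eqP; rewrite eq_le hom andTb -/(cmod a).
  have [->|a0] := eqVneq a 0; first by rewrite /cmod normr0 mul0r p_ge0.
  have ca : 0 < cmod a by rewrite lt_neqAle eq_sym cmod_eq0 a0 cmod_ge0.
  have := hom a^-1 (a *: v); rewrite scalerA mulVf // scale1r cmodV.
  by rewrite mulrC ler_pdivlMr // mulrC.
exists p.
  split=> //; apply: seminorm_continuous => //.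
  (* Halving yields [p v <= 2^-1], hence the strict bound; membership in [b] alone gives only
     [p v <= 1]. *)
  have := nbhs0_scale (2%:R)%:C nb; apply: filterS => v /= b2.
  apply: (@le_lt_trans _ _ (2^-1)); last lra.
  by apply: Tle; split; rewrite ?invr_gt0 // invrK.
by move=> v /Tlt [_]; rewrite invr1 scale1r => /bU.
Qed.

Lemma cvg_seminormP (T : Type) (F : set_system T) (FF : Filter F) (f : T -> V) (l : V) :
  f @ F --> l <-> forall p : V -> R, continuous_seminorm p ->
    forall e, 0 < e -> \forall x \near F, p (f x - l) < e.
Proof.
split=> [fl p cp e e0|h].
  by apply: (fl [set y | p (y - l) < e]); exact: continuous_seminorm_ball.
move=> U /nbhs_translate /minkowski [p cp pU].
have := h p cp 1 ltr01; apply: filterS => x /pU /=.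
by rewrite addrCA subrr addr0.
Qed.

Lemma closure_seminormP (A : set V) (x : V) :
  closure A x <-> forall p : V -> R, continuous_seminorm p ->
    forall e, 0 < e -> exists2 a, A a & p (a - x) < e.
Proof.
split=> [clx p cp e e0|h U /nbhs_translate /minkowski [p cp pU]].
  by have [a [Aa h]] := clx _ (continuous_seminorm_ball x cp e0); exists a.
have [a Aa /pU /=] := h p cp 1 ltr01; rewrite addrCA subrr addr0 => Ua.
by exists a.
Qed.

Lemma frechet_seminorms : frechet V -> exists p : nat -> V -> R,
  [/\ forall j, continuous_seminorm (p j),
      forall i j v, (i <= j)%N -> p i v <= p j v &
      forall U, nbhs 0 U -> exists j, forall v, p j v < 1 -> U v].
Proof.
move=> [_ [B [nB Bbase]] _].
have /boolp.choice [p pP] : forall i, exists p : V -> R,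
    continuous_seminorm p /\ forall v, p v < 1 -> B i v.
  by move=> i; have [p cp pB] := minkowski (nB i); exists p.
(* Partial sums make the family increasing, so that the successive corrections in the Mittag-Leffler
   argument are controlled by all earlier seminorms. *)
exists (fun j v => \sum_(i < j.+1) p i v); split.
- by move=> j; apply: continuous_seminorm_sum => i; case: (pP i).
- move=> i j v ij; rewrite -!(big_mkord predT (fun i => p i v)).
  rewrite (@big_cat_nat _ _ _ i.+1 0 j.+1) //= lerDl; apply: sumr_ge0 => k _.
  by apply: seminorm_ge0; case: (pP k) => -[].
- move=> U /Bbase[i BU]; exists i => v; rewrite big_ord_recr /= => h.
  apply: BU; apply: (pP i).2; apply: le_lt_trans h; rewrite lerDr.
  by apply: sumr_ge0 => k _; apply: seminorm_ge0; case: (pP k) => -[].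
Qed.

End LocallyConvex.
End Seminorms.

(** * One-parameter groups of matrices *)

Section RealDerivatives.
Variable R : realType.

(** The derivative in product form: it makes sense at [t = 0] and combines directly with norm
    estimates. *)
Definition little_o_derivative (f : R -> R) (x d : R) : Prop :=
  forall e, 0 < e -> \forall t \near (0 : R), `|f (x + t) - f x - t * d| <= e * `|t|.

Lemma is_derive_little_o (f : R -> R) (x d : R) :
  is_derive x 1 f d -> little_o_derivative f x d.
Proof.
move=> [fx fd] e e0.
have := fx; rewrite /derivable => /cvg_ex [l hl].
have ld : l = d by rewrite -fd; apply/esym/cvg_lim.
move: hl; rewrite ld => /cvgrPdist_le/(_ e e0).
rewrite near_withinE; apply: filterS => t h.
have [->|t0] := eqVneq t 0.
  by rewrite addr0 subrr sub0r mul0r oppr0 normr0 mulr0.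
have := h t0; rewrite /= [t%:A]mulr1 [_ *: _]mulrC [t + x]addrC distrC => h'.
rewrite -(ler_pdivrMr _ _ (_ : 0 < `|t|)) ?normr_gt0 // -normfV -normrM.
suff -> : (f (x + t) - f x - t * d) * t^-1 = (f (x + t) - f x) * t^-1 - d by [].
by rewrite mulrBl mulrAC mulfV // mul1r.
Qed.

Lemma local_antiderivative (f : R -> R) (b : R) : continuous f -> 0 < b ->
  exists F : R -> R, forall x : R, - b < x -> x < b -> is_derive x 1 F (f x).
Proof.
move=> cf b0.
exists (fun x : R => parameterized_integral (@lebesgue_measure R) (- b) x f) => x bx xb.
have [||Fx Fd] := @continuous_FTC1_closed R f (- b) x b xb _ bx.
- apply: continuous_compact_integrable; first exact: segment_compact.
  by apply: continuous_subspaceT => ?; exact: cf.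
- exact: cf.
by rewrite derive1E in Fd; exact: (DeriveDef Fx Fd).
Qed.

Lemma zero_derivative_eq (g : R -> R) (s : R) : 0 < s ->
  (forall r, r \in `[0, s] -> is_derive r (1 : R) g (0 : R)) -> g s = g 0.
Proof.
move=> s0 gd; have gd' (x : R) : x \in `]0, s[ -> is_derive x (1 : R) g (0 : R).
  move=> xs; apply: gd; move: xs; rewrite !in_itv /= => /andP[h1 h2].
  by rewrite !ltW.
have gc : {within `[0, s], continuous g}.
  apply: derivable_within_continuous => x xs; exact: (@ex_derive _ _ _ _ _ _ _ (gd x xs)).
have [c _] := @MVT R g (fun=> 0) 0 s s0 gd' gc.
by rewrite mul0r => /eqP; rewrite subr_eq0 => /eqP.
Qed.

Lemma near_identity_unit n (E : 'M[R]_n) : norm1 (1%:M - E) < 1 -> E \in unitmx.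
Proof.
move=> lt1; rewrite unitmxE unitfE; apply/negP => /det0P [v v0 vE].
have vv : v = v *m (1%:M - E) by rewrite mulmxBr mulmx1 vE subr0.
have nv : 0 < norm1 v.
  rewrite lt_neqAle norm1_ge0 andbT eq_sym; apply: contra v0 => /eqP nv.
  apply/eqP/matrixP => i j; rewrite mxE; apply/eqP; rewrite -normr_le0 -nv.
  rewrite /norm1 (bigD1 i) //= (bigD1 j) //= -addrA lerDl.
  by apply: addr_ge0; apply: sumr_ge0 => // k _; apply: sumr_ge0.
have := norm1M v (1%:M - E); rewrite -vv -{1}[norm1 v]mulr1 ler_pM2l //.
by rewrite leNgt lt1.
Qed.

(* If [Phi' = A], then [A t *m (Phi s - Phi 0) = Phi (t + s) - Phi t], which is
   differentiable in [t]; the constant factor is invertible for small [s]. *)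
Lemma one_param_matrix_derivative n (A : R -> 'M[R]_n) :
  (forall i j, continuous (fun t => A t i j)) -> A 0 = 1%:M ->
  (forall s t, A (s + t) = A s *m A t) ->
  exists X : 'M[R]_n, forall i j, little_o_derivative (fun t => A t i j) 0 (X i j).
Proof.
move=> cA A0 AD.
(* Radius 2, because [t + r] occurs below with [|t| < 1] and [0 <= r <= s < 1]. *)
have /boolp.choice [P0 P0d] : forall ij : 'I_n * 'I_n, exists F : R -> R,
    forall x : R, - 2 < x -> x < 2 -> is_derive x 1 F (A x ij.1 ij.2).
  by move=> [i j]; exact: local_antiderivative.
pose Phi (t : R) : 'M[R]_n := \matrix_(i, j) P0 (i, j) t.
have Phid i j (x : R) : - 2 < x -> x < 2 -> is_derive x 1 (fun t => Phi t i j) (A x i j).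
  move=> h1 h2; have -> : (fun t => Phi t i j) = P0 (i, j).
    by apply/funext => t; rewrite mxE.
  exact: (P0d (i, j)).
have Phio i j (x : R) : - 2 < x -> x < 2 ->
    little_o_derivative (fun t => Phi t i j) x (A x i j).
  by move=> h1 h2; apply: is_derive_little_o; exact: Phid.
have key t s : `|t| < 1 -> 0 < s -> s < 1 ->
    A t *m (Phi s - Phi 0) = Phi (t + s) - Phi t.
  rewrite ltr_norml => /andP[t1 t2] s0 s1; apply/matrixP => i j.
  pose g (r : R) := Phi (t + r) i j - \sum_k A t i k * Phi r k j.
  have gd r : r \in `[0, s] -> is_derive r 1 g 0.
    rewrite in_itv /= => /andP[r0 rs].
    have d1 : is_derive r 1 (fun r => Phi (t + r) i j) (A (t + r) i j).
      have dtr : is_derive (t + r) 1 (fun t => Phi t i j) (A (t + r) i j).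
        by apply: Phid; lra.
      have := @is_derive1_comp R (fun t => Phi t i j) (fun r => t + r) r _ 1 dtr.
      rewrite mulr1; apply; rewrite -[X in is_derive _ _ _ X]add0r.
      exact: is_deriveD.
    have d2 k : is_derive r 1 (fun r => A t i k * Phi r k j) (A t i k * A r k j).
      by apply: is_deriveZ; apply: Phid; lra.
    have -> : 0 = A (t + r) i j - \sum_k A t i k * A r k j.
      by rewrite AD mxE subrr.
    rewrite /g; apply: is_deriveB.
    have -> : (fun r => \sum_k A t i k * Phi r k j) =
              \sum_k (fun r => A t i k * Phi r k j).
      by apply/funext => r'; rewrite fct_sumE.
    exact: is_derive_sum.
  have := zero_derivative_eq s0 gd; rewrite /g.
  rewrite addr0 => e; rewrite mxE [RHS]mxE [(- Phi t) i j]mxE.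
  under eq_bigr => k _ do rewrite mxE [(- Phi 0) k j]mxE mulrBr.
  rewrite sumrB; move: e.
  have -> : \sum_k A t i k * Phi s k j = \sum_j0 A t i j0 * Phi s j0 j by [].
  move=> e; lra.
have [s [s0 s1 Eunit]] : exists s : R, [/\ 0 < s, s < 1 &
    s^-1 *: (Phi s - Phi 0) \in unitmx].
  (* The difference quotient of [Phi] tends to [A 0], the identity; with this [eps] the [n * n]
     entrywise errors add up to less than 1, as [near_identity_unit] requires. *)
  pose eps : R := (n * n).+1%:R^-1.
  have eps0 : 0 < eps by rewrite invr_gt0.
  have near_ij (ij : 'I_n * 'I_n) : \forall t \near (0 : R),
      `|Phi (0 + t) ij.1 ij.2 - Phi 0 ij.1 ij.2 - t * A 0 ij.1 ij.2| <= eps * `|t|.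
    by apply: Phio; lra.
  have all_near : \forall t \near (0 : R), forall ij : 'I_n * 'I_n,
      `|Phi (0 + t) ij.1 ij.2 - Phi 0 ij.1 ij.2 - t * A 0 ij.1 ij.2| <= eps * `|t|.
    exact: filter_forall near_ij.
  have /nbhs_ballP[d /= d0 sub] := all_near.
  pose s := Num.min (d / 2) 2^-1.
  have s0 : 0 < s by rewrite lt_min; apply/andP; split; rewrite ?divr_gt0 ?invr_gt0.
  have sd : s < d.
    by apply: (@le_lt_trans _ _ (d / 2)); [rewrite ge_min lexx|lra].
  have s1 : s < 1.
    by apply: (@le_lt_trans _ _ 2^-1); [rewrite ge_min lexx orbT|lra].
  exists s; split=> //; apply: near_identity_unit.
  have hs : ball 0 d s by rewrite -ball_normE /= sub0r normrN gtr0_norm.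
  have bnd i j : `|(1%:M - s^-1 *: (Phi s - Phi 0)) i j| <= eps.
    have := sub s hs (i, j); rewrite /= add0r A0 (gtr0_norm s0) => h.
    rewrite -(ler_pM2r s0) -[X in _ * X <= _](gtr0_norm s0) -normrM.
    move: h; set a := _ - _ - _ => h.
    suff -> : (1%:M - s^-1 *: (Phi s - Phi 0)) i j * s = - a by rewrite normrN.
    rewrite mxE [(- (s^-1 *: (Phi s - Phi 0))) i j]mxE.
    rewrite [(s^-1 *: (Phi s - Phi 0)) i j]mxE [(Phi s - Phi 0) i j]mxE.
    rewrite [(- Phi 0) i j]mxE /a; move: (Phi s i j) (Phi 0 i j) (1%:M i j) => x y z.
    by field; rewrite gt_eqF.
  apply: (@le_lt_trans _ _ (\sum_(i < n) \sum_(j < n) eps)).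
    by apply: ler_sum => i _; apply: ler_sum => j _; exact: bnd.
  rewrite sumr_const sumr_const !card_ord -mulrnA -[eps *+ _]mulr_natr.
  by rewrite /eps mulrC ltr_pdivrMr // mul1r ltr_nat.
pose C := Phi s - Phi 0.
have Cunit : C \in unitmx.
  by move: Eunit; rewrite unitmxZ // unitfE invr_eq0 gt_eqF.
pose D := invmx C.
have AE t : `|t| < 1 -> A t = (Phi (s + t) - Phi t) *m D.
  by move=> t1; rewrite [s + t]addrC -key // mulmxK.
exists ((A s - A 0) *m D) => i j e e0.
pose M := 1 + \sum_k `|D k j|.
have M0 : 0 < M by rewrite ltr_pwDl // sumr_ge0.
have n1 : \forall t \near (0 : R), `|t| < 1.
  have : nbhs (0 : R) (ball 0 1) by exact: nbhsx_ballx.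
  by apply: filterS => t; rewrite -ball_normE /= sub0r normrN.
have n2k k : \forall t \near (0 : R),
    `|Phi (s + t) i k - Phi s i k - t * A s i k| <= e / (2 * M) * `|t|.
  by apply: Phio; [lra|lra|rewrite divr_gt0 // mulr_gt0].
have n2 : \forall t \near (0 : R), forall k,
    `|Phi (s + t) i k - Phi s i k - t * A s i k| <= e / (2 * M) * `|t|.
  exact: filter_forall n2k.
have n3k k : \forall t \near (0 : R),
    `|Phi (0 + t) i k - Phi 0 i k - t * A 0 i k| <= e / (2 * M) * `|t|.
  by apply: Phio; [lra|lra|rewrite divr_gt0 // mulr_gt0].
have n3 : \forall t \near (0 : R), forall k,
    `|Phi (0 + t) i k - Phi 0 i k - t * A 0 i k| <= e / (2 * M) * `|t|.
  exact: filter_forall n3k.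
near=> t; have t1 : `|t| < 1 by near: t.
have h2 k : `|Phi (s + t) i k - Phi s i k - t * A s i k| <= e / (2 * M) * `|t|.
  by move: k; near: t.
have h3 k : `|Phi (0 + t) i k - Phi 0 i k - t * A 0 i k| <= e / (2 * M) * `|t|.
  by move: k; near: t.
have eA0 : A 0 i j = ((Phi s - Phi 0) *m D) i j by rewrite {1}(AE 0) ?normr0 // addr0.
have eAt : A t i j = ((Phi (s + t) - Phi t) *m D) i j by rewrite {1}(AE t t1).
rewrite add0r eAt eA0.
have -> : ((Phi (s + t) - Phi t) *m D) i j - ((Phi s - Phi 0) *m D) i j -
    t * ((A s - A 0) *m D) i j =
    \sum_k ((Phi (s + t) i k - Phi s i k - t * A s i k) -
            (Phi (0 + t) i k - Phi 0 i k - t * A 0 i k)) * D k j.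
  rewrite !mxE big_distrr -!sumrB /=; apply: eq_bigr => k _.
  rewrite add0r [(Phi (s + t) - Phi t) i k]mxE [(- Phi t) i k]mxE.
  rewrite [(Phi s - Phi 0) i k]mxE [(- Phi 0) i k]mxE.
  rewrite [(A s - A 0) i k]mxE [(- A 0) i k]mxE.
  by move: (Phi _ i k) (Phi _ i k) (Phi _ i k) (Phi _ i k) (A s i k) (A 0 i k) => *; ring.
apply: le_trans (ler_norm_sum _ _ _) _.
apply: (@le_trans _ _ (\sum_k (e / M * `|t|) * `|D k j|)).
  apply: ler_sum => k _; rewrite normrM ler_wpM2r //.
  apply: le_trans (ler_normB _ _) _; apply: le_trans (lerD (h2 k) (h3 k)) _.
  rewrite -mulrDl ler_wpM2r // -mulrDl le_eqVlt; apply/orP; left; apply/eqP.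
  by field; rewrite gt_eqF.
have -> : e * `|t| = e / M * `|t| * M by field; rewrite gt_eqF.
rewrite -big_distrr /=; apply: ler_wpM2l.
  by rewrite mulr_ge0 // divr_ge0 // ltW.
by rewrite /M lerDr.
Unshelve. all: by end_near.
Qed.
End RealDerivatives.

(** * Derivatives relative to a seminorm *)

Section SeminormDerivative.
Variable R : realType.
Local Open Scope complex_scope.
Variable V : tvsType R[i].

(** Differentiability seen by one seminorm, where [D] matters only modulo the kernel of [p]. This
    allows [p] to be a distance to a subspace. *)
Definition sderiv (p : V -> R) (phi : R -> V) (s : R) (D : V) : Prop :=
  forall e, 0 < e -> \forall t \near (0 : R),
    p (phi (s + t) - phi s - t%:C *: D) <= e * `|t|.

Lemma seminorm_quotient (p : V -> R) (t : R) (v D : V) : seminorm p -> t != 0 ->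
  p (v - t%:C *: D) = `|t| * p ((t^-1)%:C *: v - D).
Proof.
move=> sp t0; rewrite -seminormZr // scalerBr scalerA -rmorphM /= mulfV //.
by rewrite scale1r.
Qed.

Lemma cvg_sderiv (phi : R -> V) (s : R) (D : V) :
  (t^-1)%:C *: (phi (s + t) - phi s) @[t --> (0 : R)^'] --> D <->
  forall p : V -> R, continuous_seminorm p -> sderiv p phi s D.
Proof.
split=> [/cvg_seminormP h p cp e e0|h].
  have := h p cp e e0; rewrite near_withinE; apply: filterS => t ht.
  have sp := cp.1; have [->|t0] := eqVneq t 0.
    by rewrite addr0 subrr sub0r scale0r oppr0 seminorm0 // normr0 mulr0.
  rewrite seminorm_quotient // mulrC ler_pM2r ?normr_gt0 //.
  by apply/ltW/ht.
apply/cvg_seminormP => p cp e e0; have sp := cp.1.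
rewrite near_withinE; have := h p cp (e / 2) (divr_gt0 e0 (ltr0n _ 2)).
apply: filterS => t ht t0; move: ht; rewrite seminorm_quotient // mulrC.
rewrite ler_pM2r ?normr_gt0 // => ht; apply: le_lt_trans ht _; lra.
Qed.

Section MVT.
Variable p : V -> R.
Hypothesis sp : seminorm p.

Lemma sderiv_local (phi : R -> V) (s : R) (D c : V) (e e' : R) :
  sderiv p phi s D -> p (D - c) <= e -> e < e' ->
  exists2 d, 0 < d & forall t, `|t| < d ->
    p (phi (s + t) - phi s - t%:C *: c) <= e' * `|t|.
Proof.
move=> hD Dc ee'; have := hD (e' - e); rewrite subr_gt0 => /(_ ee').
move=> /nbhs_ballP[d /= d0 sub]; exists d => // t td.
have := sub t; rewrite -ball_normE /= sub0r normrN => /(_ td) h.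
have -> : phi (s + t) - phi s - t%:C *: c =
    (phi (s + t) - phi s - t%:C *: D) + t%:C *: (D - c).
  by rewrite scalerBr addrA subrK.
apply: le_trans (seminormD sp _ _) _; rewrite seminormZr //.
have := ler_wpM2l (normr_ge0 t) Dc; lra.
Qed.

(** Continuous induction on the interval: the bound with a slope [e' > e] holds up to a supremum
    [m], and the slack [e' - e] absorbs the error of the derivative at [m]. Then [e'] tends to
    [e]. *)
Lemma mvt_pos (phi dphi : R -> V) (c : V) (e h : R) : 0 < h ->
  (forall s, 0 <= s -> s <= h -> sderiv p phi s (dphi s)) ->
  (forall s, 0 <= s -> s <= h -> p (dphi s - c) <= e) ->
  p (phi h - phi 0 - h%:C *: c) <= e * h.
Proof.
move=> h0 dP cP.
suff main e' : e < e' -> p (phi h - phi 0 - h%:C *: c) <= e' * h.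
  apply/ler_addgt0Pr => eta eta0.
  have := main (e + eta / h); rewrite ltrDl divr_gt0 // => /(_ isT).
  by rewrite mulrDl divfK // gt_eqF.
move=> ee'.
pose S := [set s | [/\ 0 <= s, s <= h & p (phi s - phi 0 - s%:C *: c) <= e' * s]].
have S0 : S 0.
  split; [by []|exact: ltW|].
  by rewrite subrr sub0r scale0r oppr0 seminorm0 // mulr0.
have supS : has_sup S by split; [exists 0|exists h => s []].
have e'0 : 0 <= e'.
  have := cP 0 (lexx _) (ltW h0); have := seminorm_ge0 sp (dphi 0 - c); lra.
pose m := sup S.
have m0 : 0 <= m by apply: ub_le_sup => //; case: supS.
have mh : m <= h by apply: ge_sup; [exists 0|move=> s []].
have step a b : p (phi a - phi 0 - a%:C *: c) <= e' * a ->
    p (phi b - phi a - (b - a)%:C *: c) <= e' * (b - a) ->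
    p (phi b - phi 0 - b%:C *: c) <= e' * b.
  move=> ha hb; have -> : phi b - phi 0 - b%:C *: c =
     (phi b - phi a - (b - a)%:C *: c) + (phi a - phi 0 - a%:C *: c).
    rewrite rmorphB /= scalerBl opprB addrACA subrKA; congr (_ + _).
    by rewrite addrAC subrr sub0r.
  by apply: le_trans (seminormD sp _ _) _; lra.
(* Used on both sides of [m]: from a point of [S] just to the left it gives [S m], and just to the
   right it contradicts that [m] is the supremum. *)
have [d d0 dloc] := sderiv_local (dP m m0 mh) (cP m m0 mh) ee'.
have Sm : S m.
  split=> //; have [s Ss sm] := sup_adherent d0 supS.
  have sm' : s <= m by apply: ub_le_sup => //; case: supS.
  case: Ss => s0 sh ps; apply: (step s) => //.
  have := dloc (s - m); rewrite [m + (s - m)]addrC subrK ler0_norm ?subr_le0 // opprB.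
  rewrite -/m in sm; have -> : (m - s < d) by lra.
  move=> /(_ isT); rewrite (_ : phi s - _ - _ = - (phi m - phi s - (m - s)%:C *: c)).
    by rewrite seminormN.
  by rewrite -[s - m]opprB rmorphN /= scaleNr opprK !opprD !opprK [- phi m + _]addrC.
have [mh'|hm] := ltP m h; last first.
  have -> : h = m by apply/eqP; rewrite eq_le hm.
  by case: Sm.
exfalso; pose y := Num.min h (m + d / 2).
have my : m < y by rewrite lt_min mh' ltrDl divr_gt0.
have yh : y <= h by rewrite ge_min lexx.
have yd : y - m < d.
  have : y <= m + d / 2 by rewrite ge_min lexx orbT.
  lra.
have : y <= m.
  apply: ub_le_sup; first by case: supS.
  split=> //; first by rewrite (le_trans m0) // ltW.
  apply: (step m); first by case: Sm.
  have := dloc (y - m); rewrite [m + (y - m)]addrC subrK gtr0_norm ?subr_gt0 //.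
  exact.
by rewrite leNgt my.
Qed.

Lemma mvt_seminorm (phi dphi : R -> V) (c : V) (e h : R) :
  (forall s, `|s| <= `|h| -> sderiv p phi s (dphi s)) ->
  (forall s, `|s| <= `|h| -> p (dphi s - c) <= e) ->
  p (phi h - phi 0 - h%:C *: c) <= e * `|h|.
Proof.
move=> dP cP; have [->|h0] := eqVneq h 0.
  by rewrite subrr sub0r scale0r oppr0 seminorm0 // normr0 mulr0.
have [hlt|hgt|/eqP] := ltgtP h 0; last by rewrite (negPf h0).
  have := @mvt_pos (fun s => phi (- s)) (fun s => - dphi (- s)) (- c) e (- h).
  rewrite oppr_gt0 opprK oppr0 scalerN -scaleNr -rmorphN /= opprK ltr0_norm //.
  apply=> // s s0 sh.
    have ns : `|- s| <= `|h| by rewrite normrN ger0_norm // ltr0_norm.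
    move=> eta eta0; have := dP _ ns eta eta0.
    move=> /nbhs_ballP[d /= d0 sub]; apply/nbhs_ballP; exists d => // t.
    rewrite -ball_normE /= sub0r normrN => td.
    have := sub (- t); rewrite -ball_normE /= sub0r opprK => /(_ td).
    by rewrite -opprD rmorphN /= scaleNr scalerN normrN.
  rewrite addrC seminorm_distC //; apply: cP.
  by rewrite normrN ger0_norm // ltr0_norm.
rewrite gtr0_norm // in dP cP *; apply: mvt_pos hgt _ _ => s s0 sh.
  by apply: dP; rewrite ger0_norm.
by apply: cP; rewrite ger0_norm.
Qed.

End MVT.

(** * Chain rule for directionally differentiable maps along matrix curves *)

Section Chain.
Variables (n : nat) (U : set 'M[R]_n) (F : 'M[R]_n -> V) (A0 : 'M[R]_n).
Hypotheses (Uopen : open U) (UA0 : U A0).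
Variable F' : 'M[R]_n -> 'M[R]_n -> V.
Hypothesis dF : forall B A, U A -> has_deriv F A B (F' B A).
Hypothesis cF' : forall B, {for A0, continuous (F' B)}.

Lemma has_deriv_sderiv (p : V -> R) A B (s : R) : continuous_seminorm p ->
  U (A + s *: B) -> sderiv p (fun s => F (A + s *: B)) s (F' B (A + s *: B)).
Proof.
move=> cp UA; have := @dF B _ UA; rewrite /has_deriv => h.
suff : (t^-1)%:C *: (F (A + (s + t) *: B) - F (A + s *: B)) @[t --> (0 : R)^'] -->
    F' B (A + s *: B).
  by move=> h'; apply: (iffLR (cvg_sderiv (fun s => F (A + s *: B)) s _) h').
by under eq_fun do rewrite scalerDl addrA.
Qed.

Lemma sum_small (l : seq ('M[R]_n * (R -> R) * R)) (r : R) :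
  (forall x, x \in l -> x.1.2 0 = 0 /\ little_o_derivative x.1.2 0 x.2) ->
  0 < r -> \forall t \near (0 : R), `|\sum_(x <- l) x.1.2 t *: x.1.1| < r.
Proof.
elim: l r => [|[[B h] a] l IH] r hl r0.
  by near=> t; rewrite big_nil normr0.
have [/= h0 ho] := hl _ (mem_head _ _).
have IH' := IH (r / 2) _ (divr_gt0 r0 (ltr0n _ 2)).
have {}IH' := IH' (fun x xl => hl x (mem_behead (s := (B, h, a) :: l) xl)).
have h1 := ho 1 ltr01.
pose c := (`|a| + 1) * (`|B| + 1).
have c0 : 0 < c by rewrite mulr_gt0 // ltr_wpDl.
have h2 : \forall t \near (0 : R), `|t| < r / (2 * c).
  have : nbhs (0 : R) (ball 0 (r / (2 * c))).
    by apply: nbhsx_ballx; rewrite divr_gt0 // mulr_gt0.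
  by apply: filterS => t; rewrite -ball_normE /= sub0r normrN.
near=> t; rewrite big_cons /=.
have b1 : `|\sum_(x <- l) x.1.2 t *: x.1.1| < r / 2 by near: t.
have b2 : `|h t| <= (`|a| + 1) * `|t|.
  have : `|h (0 + t) - h 0 - t * a| <= 1 * `|t| by near: t.
  rewrite add0r h0 subr0 => hh; have := ler_normD (h t - t * a) (t * a).
  by rewrite subrK normrM; lra.
have b3 : `|h t *: B| < r / 2.
  rewrite normrZ; apply: (@le_lt_trans _ _ (c * `|t|)).
    rewrite /c mulrAC; apply: ler_pM => //; lra.
  have : `|t| < r / (2 * c) by near: t.
  by rewrite -(ltr_pM2l c0) => /lt_le_trans; apply; rewrite le_eqVlt;
    apply/orP; left; apply/eqP; field; rewrite gt_eqF.
apply: le_lt_trans (ler_normD _ _) _; lra.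
Unshelve. all: by end_near.
Qed.

(** An element of [l] is a direction, the coordinate of the curve along it, and the derivative of
    that coordinate at 0. As only directional derivatives are given, one direction is added at a
    time, and the mean value inequality with [F' B] continuous at [A0] controls the new
    increment. *)
Lemma chain_rule (p : V -> R) (l : seq ('M[R]_n * (R -> R) * R)) :
  continuous_seminorm p ->
  (forall x, x \in l -> x.1.2 0 = 0 /\ little_o_derivative x.1.2 0 x.2) ->
  sderiv p (fun t => F (A0 + \sum_(x <- l) x.1.2 t *: x.1.1)) 0
    (\sum_(x <- l) (x.2)%:C *: F' x.1.1 A0).
Proof.
move=> cp; have sp := cp.1; elim: l => [|[[B h] a] l IH] hl.
  move=> e e0; near=> t.
  by rewrite !big_nil subrr sub0r scaler0 oppr0 seminorm0 // mulr_ge0 // ltW.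
have [/= h0 ho] := hl _ (mem_head _ _).
have hl' x : x \in l -> x.1.2 0 = 0 /\ little_o_derivative x.1.2 0 x.2.
  by move=> xl; apply: hl; rewrite inE xl orbT.
move=> e e0.
pose X t := A0 + \sum_(x <- l) x.1.2 t *: x.1.1.
pose D := \sum_(x <- l) (x.2)%:C *: F' x.1.1 A0.
pose pF := p (F' B A0).
have pF0 : 0 <= pF by exact: seminorm_ge0.
have a0 : 0 <= `|a| by [].
(* Near 0, [h t] is at most [|a| + 1] times [|t|], so an error [eps] per unit of [h t] costs a third
   of [e]; the other two thirds go to the induction hypothesis and to the error of [h]. *)
pose eps := e / (3 * (`|a| + 1)).
have eps0 : 0 < eps by rewrite divr_gt0 // mulr_gt0 // ltr_wpDl.
have [r r0 rP] : exists2 r, 0 < r & forall Y, `|Y - A0| < r ->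
    U Y /\ p (F' B Y - F' B A0) <= eps.
  have n1 : nbhs A0 U by exact: open_nbhs_nbhs.
  have n2 : nbhs A0 [set Y | p (F' B Y - F' B A0) < eps].
    exact: (@cF' B _ (continuous_seminorm_ball (F' B A0) cp eps0)).
  have n12 : nbhs A0 (U `&` [set Y | p (F' B Y - F' B A0) < eps]) by exact: filterI.
  move: n12 => /nbhs_ballP[r /= r0 sub]; exists r => // Y Yr.
  have [|UY h2] := sub Y; first by rewrite -ball_normE /= distrC.
  by split=> //; exact: ltW.
have Xsmall := sum_small hl' (divr_gt0 r0 (ltr0n _ 2)).
have hsmall : \forall t \near (0 : R), `|\sum_(x <- [:: (B, h, a)]) x.1.2 t *: x.1.1| < r / 2.
  by apply: sum_small => [x|]; [rewrite inE => /eqP ->|rewrite divr_gt0].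
have h1 := ho 1 ltr01.
have h2 := ho (e / (3 * (pF + 1))) (divr_gt0 e0 (mulr_gt0 (ltr0n _ 3) (ltr_wpDl pF0 ltr01))).
have h3 := IH hl' (e / 3) (divr_gt0 e0 (ltr0n _ 3)).
near=> t.
rewrite !big_cons /= -/D h0 scale0r !add0r.
have -> : A0 + (h t *: B + \sum_(x <- l) x.1.2 t *: x.1.1) = X t + h t *: B.
  by rewrite [h t *: B + _]addrC addrA.
have ht1 : `|h t| <= (`|a| + 1) * `|t|.
  have : `|h (0 + t) - h 0 - t * a| <= 1 * `|t| by near: t.
  rewrite add0r h0 subr0 => hh; have := ler_normD (h t - t * a) (t * a).
  by rewrite subrK normrM; lra.
have e1 : p (F (X t) - F (X 0) - t%:C *: D) <= e / 3 * `|t|.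
  have : p (F (X (0 + t)) - F (X 0) - t%:C *: D) <= e / 3 * `|t| by near: t.
  by rewrite add0r.
have e2 : p ((h t)%:C *: F' B A0 - t%:C *: (a%:C *: F' B A0)) <= e / 3 * `|t|.
  rewrite scalerA -rmorphM -scalerBl -rmorphB /= seminormZr //.
  have : `|h (0 + t) - h 0 - t * a| <= e / (3 * (pF + 1)) * `|t| by near: t.
  rewrite add0r h0 subr0 -/pF => /(ler_wpM2r pF0) hh; apply: le_trans hh _.
  have pF1 : 0 < pF + 1 by rewrite ltr_wpDl.
  have -> : e / (3 * (pF + 1)) * `|t| * pF = e / 3 * `|t| * (pF / (pF + 1)).
    by field; rewrite gt_eqF.
  apply: ler_piMr; first by rewrite mulr_ge0 // divr_ge0 // ltW.
  by rewrite ler_pdivrMr // mul1r lerDl.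
have e3 : p (F (X t + h t *: B) - F (X t) - (h t)%:C *: F' B A0) <= e / 3 * `|t|.
  have inball s : `|s| <= `|h t| -> `|X t + s *: B - A0| < r.
    move=> sh; have -> : X t + s *: B - A0 = \sum_(x <- l) x.1.2 t *: x.1.1 + s *: B.
      by rewrite /X addrAC [A0 + _ - _]addrAC subrr add0r.
    have b1 : `|\sum_(x <- l) x.1.2 t *: x.1.1| < r / 2 by near: t.
    have b2 : `|\sum_(x <- [:: (B, h, a)]) x.1.2 t *: x.1.1| < r / 2 by near: t.
    move: b2; rewrite big_seq1 /= normrZ => b2.
    have b3 : `|s *: B| <= `|h t| * `|B| by rewrite normrZ ler_wpM2r.
    by apply: le_lt_trans (ler_normD _ _) _; lra.
  have m := @mvt_seminorm p sp (fun s => F (X t + s *: B)) (fun s => F' B (X t + s *: B))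
    (F' B A0) eps (h t).
  have : p (F (X t + h t *: B) - F (X t + 0 *: B) - (h t)%:C *: F' B A0) <= eps * `|h t|.
    apply: m => s /inball/rP[UY pY] //.
    exact: has_deriv_sderiv.
  rewrite scale0r addr0 => hh; apply: le_trans hh _.
  apply: le_trans (ler_wpM2l (ltW eps0) ht1) _; rewrite mulrA ler_wpM2r //.
  rewrite /eps le_eqVlt; apply/orP; left; apply/eqP; field.
  by rewrite gt_eqF // ltr_wpDl.
have -> : F (X t + h t *: B) - F (A0 + \sum_(j <- l) j.1.2 0 *: j.1.1) -
    t%:C *: (a%:C *: F' B A0 + D) =
    (F (X t + h t *: B) - F (X t) - (h t)%:C *: F' B A0) +
    ((h t)%:C *: F' B A0 - t%:C *: (a%:C *: F' B A0)) +
    (F (X t) - F (X 0) - t%:C *: D).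
  rewrite scalerDr -/(X 0); move: (F _) (F _) (F _) (_ *: F' B A0) (_ *: (_ *: _)) (_ *: D).
  move=> x y z u v w; rewrite subrKA.
  by rewrite [RHS]addrACA subrKA -opprD.
apply: le_trans (seminormD sp _ _) _.
by have := seminormD sp (F (X t + h t *: B) - F (X t) - (h t)%:C *: F' B A0)
  ((h t)%:C *: F' B A0 - t%:C *: (a%:C *: F' B A0)); lra.
Unshelve. all: by end_near.
Qed.
End Chain.
End SeminormDerivative.

(** * Powers of the Lie algebra and of the augmentation ideal *)

Section ClosedSpans.
Variables (R : realType) (V : tvsType R[i]).
Local Open Scope complex_scope.

Lemma in_closed_span (S : set V) v : (v \in closed_span S) <-> closure (lspan S) v.
Proof. by split=> [/set_mem|h]; last exact/mem_set. Qed.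

Lemma lspan_gen (S : set V) v : S v -> lspan S v.
Proof.
move=> Sv; exists 1%N, (fun=> 1), (fun=> v); split=> //.
by rewrite big_ord1 scale1r.
Qed.

Lemma gen_closed_span (S : set V) v : S v -> v \in closed_span S.
Proof. by move=> Sv; apply/in_closed_span/subset_closure/lspan_gen. Qed.

Lemma closure_closed_span (S : set V) v : closure [set x | x \in closed_span S] v ->
  v \in closed_span S.
Proof.
move=> clv; apply/in_closed_span/closure_seminormP => p cp e e0.
have [w /in_closed_span/closure_seminormP/(_ p cp _ (divr_gt0 e0 (ltr0n _ 2))) [a Sa wa] vw] :=
  iffLR (closure_seminormP _ _) clv p cp _ (divr_gt0 e0 (ltr0n _ 2)).
exists a => //; rewrite -(subrKA w); apply: le_lt_trans (seminormD cp.1 _ _) _; lra.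
Qed.

Lemma closed_span_map (S T : set V) (f : V -> V) : continuous f ->
  (forall a x y, f (a *: x + y) = a *: f x + f y) ->
  (forall x, S x -> f x \in closed_span T) ->
  forall x, x \in closed_span S -> f x \in closed_span T.
Proof.
move=> cf lf ST x /in_closed_span clx.
have f0 : f 0 = 0.
  by have := lf 1 0 0; rewrite !scale1r addr0 => /(congr1 (+%R^~ (- f 0)));
    rewrite /= subrr addrK => <-.
have spanT y : lspan S y -> f y \in closed_span T.
  move=> [m [c [z [Sz ->]]]]; elim/big_rec : _ => [|i w _ Hw].
    by rewrite f0 rpred0.
  by rewrite lf rpredD // rpredZ // ST.
apply: closure_closed_span => B /cf /clx [w [Sw Bw]].
by exists (f w); split=> //; exact: spanT.
Qed.

Lemma closed_span_sub (S T : set V) : (forall x, S x -> x \in closed_span T) ->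
  forall x, x \in closed_span S -> x \in closed_span T.
Proof. by move=> ST; apply: (closed_span_map (f := id)) => // x; exact: cvg_id. Qed.

Lemma seminorm_closed_span0 (p : V -> R) (S : set V) : continuous_seminorm p ->
  (forall v, S v -> p v = 0) -> forall v, v \in closed_span S -> p v = 0.
Proof.
move=> cp pS v /in_closed_span; apply: seminorm_closure0 => //.
by move=> w; apply: (seminorm_lspan0 (proj1 cp) pS).
Qed.

End ClosedSpans.

(** * Lie algebra action and finite differences along one-parameter groups *)

Section LieAction.
Variables (R : realType) (N : topGroupType) (V : tvsType R[i]) (act : N -> V -> V).
Local Open Scope complex_scope.
Hypothesis hausV : hausdorff_space V.
Hypothesis act1 : forall v, act 1%g v = v.
Hypothesis actM : forall g h v, act (g * h)%g v = act g (act h v).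
Hypothesis actL : forall g (a : R[i]) v w, act g (a *: v + w) = a *: act g v + act g w.
Hypothesis actC : continuous (fun x : N * V => act x.1 x.2).
Hypothesis act_diff : forall (gamma : R -> N) v, one_param gamma ->
  (t^-1)%:C *: (act (gamma t) v - v) @[t --> (0 : R)^'] --> lie_act act gamma v.

Lemma act_continuous g : continuous (act g).
Proof.
move=> v; apply: (@continuous_comp V (N * V)%type V (fun y => (g, y))
    (fun z => act z.1 z.2)); last exact: actC.
by apply: cvg_pair; [exact: cvg_cst|exact: cvg_id].
Qed.

Lemma act0 g : act g 0 = 0.
Proof.
by have := actL g 1 0 0; rewrite !scale1r addr0 => /(congr1 (+%R^~ (- act g 0)));
  rewrite /= subrr addrK => <-.
Qed.

Lemma actD g v w : act g (v + w) = act g v + act g w.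
Proof. by have := actL g 1 v w; rewrite !scale1r. Qed.

Lemma actZ g a v : act g (a *: v) = a *: act g v.
Proof. by have := actL g a v 0; rewrite act0 !addr0. Qed.

Lemma actB g v w : act g (v - w) = act g v - act g w.
Proof. by rewrite -scaleN1r actD actZ scaleN1r. Qed.

Definition conj_path (g : N) (gamma : R -> N) (t : R) : N := (g * gamma t * g^-1)%g.

Lemma one_param_conj g gamma : one_param gamma -> one_param (conj_path g gamma).
Proof.
move=> [cg gD]; split; last first.
  by move=> s t; rewrite /conj_path gD !mulgA mulgVK.
move=> t; pose m (x : N * N) := (x.1 * x.2)%g.
have cm (a b : N) : {for (a, b), continuous m} by exact: mulg_continuous.
have c1 : (g * gamma u)%g @[u --> t] --> (g * gamma t)%g.
  apply: (@continuous_comp R (N * N)%type N (fun u => (g, gamma u)) m); last exact: cm.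
  by apply: cvg_pair; [exact: cvg_cst|exact: cg].
apply: (@continuous_comp R (N * N)%type N (fun u => (g * gamma u, g^-1)%g) m); last exact: cm.
by apply: cvg_pair; [exact: c1|exact: cvg_cst].
Qed.

(** Makes [lie_set k] stable under [N]. As [lie_act] is a chosen limit, uniqueness of limits is what
    identifies the two sides. *)
Lemma act_lie_act g gamma v : one_param gamma ->
  act g (lie_act act gamma v) = lie_act act (conj_path g gamma) (act g v).
Proof.
move=> og.
have e t : (t^-1)%:C *: (act (conj_path g gamma t) (act g v) - act g v) =
    act g ((t^-1)%:C *: (act (gamma t) v - v)).
  by rewrite actZ actB -!actM /conj_path mulgVK.
have c1 : (t^-1)%:C *: (act (conj_path g gamma t) (act g v) - act g v)
    @[t --> (0 : R)^'] --> act g (lie_act act gamma v).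
  under eq_fun do rewrite e.
  apply: (@cvg_comp _ _ _ _ (act g)); first exact: (@act_diff gamma v og).
  exact: act_continuous.
have c2 := @act_diff _ (act g v) (one_param_conj g og).
exact: (cvg_unique hausV c1 c2).
Qed.

(** Recursive form of [lie_monomials], suited to induction on the outermost factor. *)
Fixpoint lie_set (k : nat) : set V :=
  if k is k'.+1 then
    [set w | exists gamma x, [/\ one_param gamma, lie_set k' x & w = lie_act act gamma x]]
  else setT.

Lemma lie_monomialsE k : lie_monomials act k = lie_set k.
Proof.
elim: k => [|k IH].
  apply/seteqP; split=> // w _; exists [tuple], w; split=> //.
  by case.
apply/seteqP; split=> w /=.
  move=> [X [v [oX ->]]]; case/tupleP: X oX => gamma X oX.
  exists gamma, (foldr (lie_act act) v X); split=> //.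
    by have := oX ord0; rewrite tnth0.
  rewrite -IH; exists X, v; split=> // i.
  by have := oX (lift ord0 i); rewrite tnthS.
move=> [gamma [x [og]]]; rewrite -IH => -[X [v [oX ->]]] ->.
exists [tuple of gamma :: X], v; split=> // i.
by case: (unliftP ord0 i) => [j|] ->; rewrite ?tnthS ?tnth0.
Qed.

Lemma act_lie_set g k x : lie_set k x -> lie_set k (act g x).
Proof.
elim: k x => //= k IH _ [gamma [x [og Lx ->]]].
exists (conj_path g gamma), (act g x); split; [exact: one_param_conj|exact: IH|].
exact: act_lie_act.
Qed.

Lemma lie_set_sub m k x : (m <= k)%N -> lie_set k x -> lie_set m x.
Proof.
elim: m k x => // m IH [//|k] x mk /= [gamma [y [og Ly ->]]].
by exists gamma, y; split=> //; exact: IH Ly.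
Qed.

Definition flow (u : N) : Prop := exists gamma : R -> N, one_param gamma /\ exists t, u = gamma t.

Lemma one_param0 (gamma : R -> N) : one_param gamma -> gamma 0 = 1%g.
Proof.
move=> [_ gD]; have := gD 0 0; rewrite addr0 => /(congr1 (fun x => (gamma 0)^-1 * x)%g).
by rewrite mulVg mulKg.
Qed.

Lemma flowX u k : flow u -> flow (u ^+ k)%g.
Proof.
move=> [gamma [og [t ->]]]; exists gamma; split=> //; exists (k%:R * t).
elim: k => [|k IH]; first by rewrite expg0 mul0r one_param0.
by rewrite expgS IH -natr1 mulrDl mul1r addrC; case: og => _ ->.
Qed.

Definition diffs (l : seq N) (v : V) : V := foldr (fun u x => act u x - x) v l.

(** The analogue of [lie_set k] for the powers of the augmentation ideal, with group elements taken
    on one-parameter subgroups. *)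
Definition diff_set (k : nat) : set V :=
  [set w | exists l v, [/\ size l = k, forall u, u \in l -> flow u & w = diffs l v]].

Lemma orbit_derivative gamma x (p : V -> R) s : one_param gamma -> continuous_seminorm p ->
  sderiv p (fun s => act (gamma s) x) s (act (gamma s) (lie_act act gamma x)).
Proof.
move=> og cp; apply: (iffLR (cvg_sderiv (fun s => act (gamma s) x) s _)) => //.
have e t : (t^-1)%:C *: (act (gamma (s + t)) x - act (gamma s) x) =
    act (gamma s) ((t^-1)%:C *: (act (gamma t) x - x)).
  by case: og => _ ->; rewrite actZ actB actM.
under eq_fun do rewrite e.
apply: (@cvg_comp _ _ _ _ (act (gamma s))); first exact: (@act_diff gamma x og).
exact: act_continuous.
Qed.

(** The orbit of [x] under [gamma] has its derivatives in [lie_set k.+1], by stability under [N].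
    For the distance [q] to the span of this set the derivative is therefore zero, and the mean
    value inequality with [c = 0] and [e = 0] keeps the orbit at distance 0 from [x]. *)
Lemma diff_lie_set u k x : flow u -> lie_set k x ->
  act u x - x \in closed_span (lie_set k.+1).
Proof.
move=> [gamma [og [t ->]]] Lx; apply/in_closed_span/closure_seminormP => p cp e e0.
have [W0 WL] := lspan_submod (lie_set k.+1).
pose q := dist_seminorm p (lspan (lie_set k.+1)).
have sq : seminorm q by exact: dist_seminormP cp.1 W0 WL.
have cq : continuous_seminorm q.
  by apply: (dominated_seminorm_continuous cp sq) => v; exact: (dist_le_seminorm (proj1 cp) W0).
have : q (act (gamma t) x - act (gamma 0) x - t%:C *: 0) <= 0 * `|t|.
  apply: (mvt_seminorm sq (phi := fun s => act (gamma s) x)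
    (dphi := fun s => act (gamma s) (lie_act act gamma x))) => s _.
    exact: orbit_derivative.
  rewrite subr0 /q (dist_zero cp.1 W0 WL) //; apply: lspan_gen.
  by apply: act_lie_set; exists gamma, x.
rewrite mul0r scaler0 subr0 one_param0 // act1 => q0.
have [w Ww wlt] := dist_lt W0 (le_lt_trans q0 e0).
exists (- w); last by rewrite -opprD (seminormN (proj1 cp)) addrC.
by rewrite -scaleN1r -[_ *: _]addr0; exact: WL.
Qed.

Lemma diff_map_continuous u : continuous (fun x => act u x - x).
Proof.
move=> x; apply: (@continuous_comp V (V * V)%type V (fun y => (act u y, y))
    (fun z => z.1 - z.2)); last exact: sub_continuous.
by apply: cvg_pair; [exact: act_continuous|exact: cvg_id].
Qed.

Lemma diff_map_linear u a x y :
  act u (a *: x + y) - (a *: x + y) = a *: (act u x - x) + (act u y - y).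
Proof. by rewrite actL scalerBr opprD addrACA. Qed.

Lemma diff_set_closed_span k w : diff_set k w -> w \in closed_span (lie_set k).
Proof.
move=> [l [v [<- fl ->]]]; elim: l fl => [|u l IH] fl; first exact: gen_closed_span.
apply: (@closed_span_map _ _ (lie_set (size l)) (lie_set (size l).+1)
  (fun x => act u x - x) (@diff_map_continuous u) (@diff_map_linear u) _ (diffs l v)).
  by move=> x; apply: diff_lie_set; apply: fl; rewrite mem_head.
by apply: IH => w' wl; apply: fl; rewrite inE wl orbT.
Qed.

(** A derivative is a limit of difference quotients, and [u - 1] maps [closed_span (diff_set k)]
    into [closed_span (diff_set k.+1)] by continuity. *)
Lemma lie_set_closed_span k w : lie_set k w -> w \in closed_span (diff_set k).
Proof.
elim: k w => [|k IH] w; first by move=> _; apply: gen_closed_span; exists [::], w.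
move=> /= [gamma [x [og Lx ->]]]; apply: closure_closed_span => B nB.
have : \forall t \near (0 : R)^', B ((t^-1)%:C *: (act (gamma t) x - x)).
  exact: (@act_diff gamma x og B nB).
rewrite near_withinE => nb.
have /nbhs_ballP[d /= d0 sub] := nb.
exists (((d / 2)^-1)%:C *: (act (gamma (d / 2)) x - x)); split; last first.
  apply: sub; last by rewrite gt_eqF // divr_gt0.
  rewrite -ball_normE /= sub0r normrN gtr0_norm ?divr_gt0 //; lra.
change (((d / 2)^-1)%:C *: (act (gamma (d / 2)) x - x) \in closed_span (diff_set k.+1)).
apply: rpredZ.
apply: (@closed_span_map _ _ (diff_set k) (diff_set k.+1)
  (fun x => act (gamma (d / 2)) x - x) (@diff_map_continuous _) (@diff_map_linear _) _ x);
  last exact: IH.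
move=> _ [l [v [<- fl ->]]]; apply: gen_closed_span.
exists (gamma (d / 2) :: l), v; split=> // u; rewrite inE => /orP[/eqP ->|]; last exact: fl.
by exists gamma; split=> //; exists (d / 2).
Qed.

Lemma diffs_linear l a x y : diffs l (a *: x + y) = a *: diffs l x + diffs l y.
Proof. by elim: l => //= u l ->; exact: diff_map_linear. Qed.

Lemma diffsD l x y : diffs l (x + y) = diffs l x + diffs l y.
Proof. by have := diffs_linear l 1 x y; rewrite !scale1r. Qed.

Lemma diffs0 l : diffs l 0 = 0.
Proof. by elim: l => //= u l ->; rewrite act0 subrr. Qed.

Lemma diffsZ l a x : diffs l (a *: x) = a *: diffs l x.
Proof. by have := diffs_linear l a x 0; rewrite diffs0 !addr0. Qed.

Lemma diffs_cat l l' x : diffs (l ++ l') x = diffs l (diffs l' x).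
Proof. exact: foldr_cat. Qed.

(** From [u^k - 1 = sum_(j < k) u^j (u - 1)] with [u^j = 1 + (u^j - 1)]; the correction terms are
    differences of one order more. *)
Lemma diff_power u k x :
  act (u ^+ k)%g x - x = k%:R *: (act u x - x) + \sum_(j < k) diffs [:: (u ^+ j)%g; u] x.
Proof.
elim: k => [|k IH]; first by rewrite expg0 act1 subrr scale0r big_ord0 addr0.
rewrite big_ord_recr -natr1 scalerDl scale1r [diffs [:: (u ^+ k)%g; u] x]/=.
set d := act u x - x in IH *; set S := \sum_(j < k) _ in IH *.
have -> : k%:R *: d + d + (S + (act (u ^+ k)%g d - d)) = (k%:R *: d + S) + act (u ^+ k)%g d.
  by rewrite addrACA [d + _]addrC subrK.
by rewrite -IH /d actB -actM -expgSr [RHS]addrC subrKA.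
Qed.

(** * Descent from order M + 1 to order M *)

Section Downward.
Variables (p q : V -> R) (E M : nat).
Hypotheses (sq : seminorm q) (qp : forall v, q v <= p v).
Hypothesis sp : seminorm p.
Hypothesis growth : forall (l : seq N) v, exists2 C, 0 <= C &
  forall k, p (act (foldr (fun u x => u ^+ k * x)%g 1%g l) v) <= C * k.+1%:R ^+ E.
Hypothesis EM : (E < M)%N.
Hypothesis q0 : forall w, diff_set M.+1 w -> q w = 0.

(* Modulo [diffs] of length [M.+1], [u ^+ k - 1] acts as [k * (u - 1)]. *)
Lemma diff_power_homogeneous (r l : seq N) v k : (size l + size r)%N = M ->
  (forall u, u \in l -> flow u) -> (forall u, u \in r -> flow u) ->
  q (diffs l (diffs [seq (u ^+ k)%g | u <- r] v - (k ^ size r)%:R *: diffs r v)) = 0.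
Proof.
elim: r l => [|u r IH] l sz fl fr /=; first by rewrite expn0 scale1r subrr diffs0 seminorm0.
have fu : flow u by apply: fr; rewrite mem_head.
have fr' w : w \in r -> flow w by move=> wr; apply: fr; rewrite inE wr orbT.
set Rk := diffs _ v; set R1 := diffs r v; set s := size r.
(* In the first summand [u ^+ k] moves to the prefix [l], where the induction hypothesis applies;
   together with [l], the second consists of differences of length [M.+1], which [q] kills. *)
have -> : act (u ^+ k)%g Rk - Rk - (k ^ s.+1)%:R *: (act u R1 - R1) =
    diffs [:: (u ^+ k)%g] (Rk - (k ^ s)%:R *: R1) +
    (k ^ s)%:R *: (\sum_(j < k) diffs [:: (u ^+ j)%g; u] R1).
  have -> : \sum_(j < k) diffs [:: (u ^+ j)%g; u] R1 =
      (act (u ^+ k)%g R1 - R1) - k%:R *: (act u R1 - R1).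
    by rewrite diff_power addrC addKr.
  have -> : Rk - (k ^ s)%:R *: R1 = (- (k ^ s)%:R) *: R1 + Rk by rewrite addrC scaleNr.
  rewrite [diffs _ (_ + _)]/= diff_map_linear.
  rewrite [X in _ = _ + X]scalerBr scalerA scaleNr -natrM -expnSr.
  by rewrite [- _ + (_ - Rk)]addrC subrKA.
rewrite diffsD diffsZ -diffs_cat cats1.
apply/eqP; rewrite eq_le seminorm_ge0 // andbT.
apply: le_trans (seminormD sq _ _) _.
rewrite IH //; last 2 first.
- by rewrite size_rcons -sz /= addSnnS.
- move=> w; rewrite mem_rcons inE => /orP[/eqP ->|]; last exact: fl.
  exact: flowX.
rewrite add0r seminormZ //.
suff -> : q (diffs l (\sum_(j < k) diffs [:: (u ^+ j)%g; u] R1)) = 0 by rewrite mulr0.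
apply/eqP; rewrite eq_le seminorm_ge0 // andbT.
have -> : diffs l (\sum_(j < k) diffs [:: (u ^+ j)%g; u] R1) =
    \sum_(j < k) diffs l (diffs [:: (u ^+ j)%g; u] R1).
  by elim/big_ind2 : _ => [|x1 x2 y1 y2 <- <-|//]; rewrite ?diffs0 ?diffsD.
apply: le_trans (seminorm_sum sq _ _) _; rewrite big1 // => j _.
rewrite /R1 -!diffs_cat; apply: q0; exists ((l ++ [:: (u ^+ j)%g; u]) ++ r), v; split=> //.
  by rewrite !size_cat -sz /=; lia.
move=> w; rewrite !mem_cat !inE => /orP[/orP[|/orP[/eqP ->|/eqP ->]]|] //.
- exact: fl.
- exact: flowX.
- exact: fr'.
Qed.

(** Each difference is expanded into its two terms, leaving finitely many products of [k]-th powers,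
    all bounded with the same exponent [E]. The prefix [l] collects the powers met on the way. *)
Lemma diffs_growth (r l : seq N) v : exists2 C, 0 <= C & forall k,
  p (act (foldr (fun u x => u ^+ k * x)%g 1%g l) (diffs [seq (u ^+ k)%g | u <- r] v))
    <= C * k.+1%:R ^+ E.
Proof.
elim: r l => [|u r IH] l; first exact: growth.
have [C C0 CP] := IH l; have [C' C'0 CP'] := IH (rcons l u).
exists (C' + C) => [|k]; first exact: addr_ge0.
rewrite /= actB mulrDl; apply: le_trans (seminormB sp _ _) _; apply: lerD => //.
have e : foldr (fun u x => u ^+ k * x)%g 1%g (rcons l u) =
    (foldr (fun u x => u ^+ k * x)%g 1%g l * u ^+ k)%g.
  elim: (l) => [|w l' IHl] /=; first by rewrite mul1g mulg1.
  by rewrite IHl mulgA.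
by rewrite -actM -e.
Qed.

Lemma diff_set_downward w : diff_set M w -> q w = 0.
Proof.
move=> [r [v [sz fr ->]]].
have [C C0 CP] := diffs_growth r [::] v.
(* This is [k ^+ M * q <= C * k.+1 ^+ E] after division by [k ^+ E]: [E < M] leaves a power of [k]
   on the left, and [2 ^+ E] comes from [k.+1 <= 2 * k]. A bound uniform in [k] forces [q] to
   vanish. *)
have main k : (0 < k)%N -> k%:R * q (diffs r v) <= C * 2 ^+ E.
  move=> k0; have kR : 0 < k%:R :> R by rewrite ltr0n.
  have h1 : q ((k ^ M)%:R *: diffs r v) <= C * k.+1%:R ^+ E.
    have hz := @diff_power_homogeneous r [::] v k sz _ fr.
    rewrite /= sz in hz.
    rewrite -[X in q X](subKr (diffs [seq (u ^+ k)%g | u <- r] v)).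
    apply: le_trans (seminormB sq _ _) _; rewrite hz // addr0.
    by apply: le_trans (qp _) _; have := CP k; rewrite /= act1.
  have h2 : q ((k ^ M)%:R *: diffs r v) = k%:R ^+ M * q (diffs r v).
    have -> : (k ^ M)%:R = (k%:R ^+ M)%:C :> R[i].
      by rewrite natrX rmorphXn /= (rmorph_nat (real_complex R)).
    by rewrite seminormZr // ger0_norm // exprn_ge0 // ltW.
  rewrite h2 in h1.
  have k2 : k.+1%:R <= 2 * k%:R :> R by rewrite -natrM ler_nat mul2n -addnn -addn1 leq_add2l.
  have h3 : k.+1%:R ^+ E <= 2 ^+ E * k%:R ^+ E :> R.
    by rewrite -exprMn; apply: lerXn2r; rewrite ?nnegrE ?mulr_ge0 // ltW.
  have h4 : (k%:R : R) ^+ E.+1 <= k%:R ^+ M by rewrite ler_weXn2l // ler1n.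
  have kE : 0 < (k%:R : R) ^+ E by rewrite exprn_gt0.
  rewrite -(ler_pM2l kE); apply: (@le_trans _ _ (k%:R ^+ M * q (diffs r v))).
    by rewrite mulrA -exprSr ler_wpM2r ?seminorm_ge0.
  apply: le_trans h1 _; rewrite mulrCA ler_wpM2l // mulrC; exact: h3.
apply/eqP; rewrite eq_le seminorm_ge0 // andbT leNgt; apply/negP => qpos.
pose k := (Num.truncn (C * 2 ^+ E / q (diffs r v))).+1.
have := main k isT; rewrite leNgt => /negP; apply.
rewrite -ltr_pdivrMr //.
have C2 : 0 <= C * 2 ^+ E by rewrite mulr_ge0 // exprn_ge0.
by have /andP[_] := Num.Theory.truncn_itv (divr_ge0 C2 (ltW qpos)).
Qed.
End Downward.

Hypothesis growth : forall p : V -> R, continuous_seminorm p -> exists E : nat,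
  forall (l : seq N) v, exists2 C, 0 <= C &
    forall k, p (act (foldr (fun u x => u ^+ k * x)%g 1%g l) v) <= C * k.+1%:R ^+ E.

(* Beyond an order depending on [p] alone, [n^m V] and [n^m' V] have the same
   closure for [p]. *)
Lemma lie_set_dense (p : V -> R) : continuous_seminorm p -> exists m : nat,
  forall m' w e, (m <= m')%N -> lspan (lie_set m) w -> 0 < e ->
    exists2 w', lspan (lie_set m') w' & p (w' - w) < e.
Proof.
move=> cp; have [E EP] := growth cp; exists E.+1 => m' w e mm' Lw e0.
have [W0 WL] := lspan_submod (lie_set m').
pose q := dist_seminorm p (lspan (lie_set m')).
have sq : seminorm q by exact: dist_seminormP cp.1 W0 WL.
have qp v : q v <= p v by exact: dist_le_seminorm cp.1 W0 v.
have cq : continuous_seminorm q by exact: (dominated_seminorm_continuous cp sq qp).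
have qL v : lie_set m' v -> q v = 0.
  by move=> Lv; apply: (dist_zero cp.1 W0 WL); exact: lspan_gen.
(* The descent starts at order [m'], where [q] vanishes by construction, and stops at [E.+1], the
   last order above [E]. The exponent for [p] serves every [m'] because [q] is dominated by [p]. *)
have down j : (j <= m' - E.+1)%N -> forall v, diff_set (m' - j) v -> q v = 0.
  elim: j => [|j IH] jm v.
    rewrite subn0 => /diff_set_closed_span; exact: seminorm_closed_span0.
  apply: (diff_set_downward sq qp cp.1 EP).
    by lia.
  by rewrite -subSn; [rewrite subSS; apply: IH; exact: ltnW|lia].
have qw : q w = 0.
  move: w Lw; apply: seminorm_lspan0 => // v /lie_set_closed_span.
  apply: seminorm_closed_span0 => // x.
  by rewrite -{1}(subKn mm'); exact: down.
have [x Wx px] : exists2 x, lspan (lie_set m') x & p (w + x) < e.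
  by apply: (dist_lt W0); rewrite -/(q w) qw.
exists (- x); last by rewrite -opprD (seminormN (proj1 cp)) addrC.
by rewrite -scaleN1r -[_ *: _]addr0; exact: WL.
Qed.

End LieAction.

(** * Quotients and intersections *)

Section QuotientTopology.
Variables (R : realType) (V : tvsType R[i]) (W : submodule V).
Local Open Scope complex_scope.

Definition quotient_seminorm (p : V -> R) (x : quot_tvs W) : R :=
  inf [set p v | v in [set v | quot_pi W v = x]].

Lemma submodule_set0 : [set w | w \in W] 0.
Proof. exact: rpred0. Qed.

Lemma submodule_set_linear a x y : [set w | w \in W] x -> [set w | w \in W] y ->
  [set w | w \in W] (a *: x + y).
Proof. by move=> xW yW; rewrite /= rpredD // rpredZ. Qed.

Lemma submodule_setN x : x \in W -> [set w | w \in W] (- x).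
Proof. by rewrite /= rpredN. Qed.

Let W0 := submodule_set0.
Let WL := submodule_set_linear.

Lemma quotient_seminormE p v :
  quotient_seminorm p (quot_pi W v) = dist_seminorm p [set w | w \in W] v.
Proof.
congr inf; apply/seteqP; split=> _ [w /= hw <-]; last first.
  exists (v + w) => //=; apply/quot_piP; by rewrite addrAC subrr add0r.
exists (w - v); last by rewrite addrC subrK.
by rewrite /=; apply/quot_piP.
Qed.

Lemma quot_piB v w : quot_pi W (v - w) = quot_pi W v - quot_pi W w.
Proof.
have := quot_piD W (v - w) w; rewrite subrK => ->.
by rewrite addrK.
Qed.

Lemma quotient_seminormP p : seminorm p -> seminorm (quotient_seminorm p).
Proof.
move=> sp; have [dD dZ] := dist_seminormP sp W0 WL; split=> [x y|a x].
  rewrite -[x]quot_pi_repr -[y]quot_pi_repr -quot_piD !quotient_seminormE.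
  exact: dD.
rewrite -[x]quot_pi_repr -[a *: _]/(quot_scale a _) quot_scaleE !quotient_seminormE.
exact: dZ.
Qed.

Lemma quotient_ball_nbhs p (x : quot_tvs W) e : continuous_seminorm p -> 0 < e ->
  nbhs x [set y | quotient_seminorm p (y - x) < e].
Proof.
move=> cp e0; have sp := cp.1.
have sd := dist_seminormP sp W0 WL.
have cd := dominated_seminorm_continuous cp sd (dist_le_seminorm sp W0).
rewrite -[x]quot_pi_repr; set v := repr x.
apply: open_nbhs_nbhs; split; last first.
  by rewrite /= -quot_piB quotient_seminormE subrr seminorm0.
suff : open ((quot_pi W : V -> quot_tvs W) @^-1`
    [set y | quotient_seminorm p (y - quot_pi W v) < e]) by [].
rewrite openE => w /=; rewrite -quot_piB quotient_seminormE => hw.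
have := continuous_seminorm_ball w cd (_ : 0 < e - dist_seminorm p [set w | w \in W] (w - v)).
rewrite subr_gt0 => /(_ hw); apply: filterS => y /= hy.
rewrite -quot_piB quotient_seminormE -(subrKA w).
by apply: le_lt_trans (seminormD sd _ _) _; rewrite -ltrBrDr.
Qed.

Lemma quotient_seminorms_define_topology (p : nat -> V -> R) :
  (forall j, continuous_seminorm (p j)) ->
  (forall U, nbhs 0 U -> exists j, forall v, p j v < 1 -> U v) ->
  defines_topology (fun j => quotient_seminorm (p j)).
Proof.
move=> cp base x A; split=> [nA|[J [e [e0 sub]]]].
  have nA' : nbhs (repr x) ((quot_pi W : V -> quot_tvs W) @^-1` A).
    apply: (@pi_continuous _ (Quotient.quot W) (repr x)).
    by have : nbhs (quot_pi W (repr x)) A by rewrite quot_pi_repr.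
  have [j jP] := base _ (iffLR (nbhs_translate _ _) nA').
  exists [:: j], 1; split=> // y /(_ j (mem_head _ _)).
  rewrite -[y]quot_pi_repr -[x]quot_pi_repr -quot_piB quotient_seminormE.
  move=> /(dist_lt W0)[c cW /jP] /=; rewrite addrA addrCA subrr addr0.
  have -> // : quot_pi W (repr y + c) = quot_pi W (repr y).
  by apply/quot_piP; rewrite addrAC subrr add0r.
apply: (filterS sub); elim: J {sub} => [|j J IH].
  by apply: filterS filterT => y _ i.
apply: filterS (filterI (quotient_ball_nbhs x (cp j) e0) IH) => y [/= h1 h2] i.
by rewrite inE => /orP[/eqP ->|]; [exact: h1|exact: h2].
Qed.

End QuotientTopology.

(** * A Mittag-Leffler argument *)

Section MittagLeffler.
Variables (R : realType) (V : tvsType R[i]) (L : nat -> set V) (p : nat -> V -> R).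
Local Open Scope complex_scope.
Hypothesis cp : forall j, continuous_seminorm (p j).
Hypothesis p_mono : forall i j v, (i <= j)%N -> p i v <= p j v.
Hypothesis p_base : forall U, nbhs 0 U -> exists j, forall v, p j v < 1 -> U v.
Hypothesis complete : forall F : set_system V, ProperFilter F ->
  (forall U, nbhs (0 : V) U -> exists2 A, F A & forall x y, A x -> A y -> U (x - y)) ->
  exists l : V, F --> l.
Hypothesis L_sub : forall m k, (m <= k)%N -> L k `<=` L m.
Hypothesis L_dense : forall j, exists m : nat, forall m' w e, (m <= m')%N ->
  lspan (L m) w -> 0 < e -> exists2 w', lspan (L m') w' & p j (w' - w) < e.

Lemma lspan_sub (S T : set V) : S `<=` T -> lspan S `<=` lspan T.
Proof.
by move=> ST _ [m [c [x [Sx ->]]]]; exists m, c, x; split=> // i; exact: ST.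
Qed.

(** Starting from [w], the term [u i] is moved into the span of a deeper [L] by a correction small
    for [p (j + i)]. As the [p i] increase, the sequence is Cauchy; its tails lie ever deeper, so
    the limit belongs to every closure. *)
Lemma mittag_leffler j : exists m : nat, forall w e, lspan (L m) w -> 0 < e ->
  exists2 l, (forall k, l \in closed_span (L k)) & p j (w - l) < e.
Proof.
have [m mP] := boolp.choice L_dense.
(* The sum makes [M] nondecreasing and at least [m]; the summand [i] makes it unbounded, so that
   every [L k] is eventually reached. *)
pose M i := (i + \sum_(i' < i.+1) m i')%N.
have mM i : (m i <= M i)%N.
  by rewrite /M big_ord_recr /= addnA leq_addl.
have MS i : (M i <= M i.+1)%N.
  by rewrite /M [in X in (_ <= X)%N]big_ord_recr /= addSn; lia.
have iM i : (i <= M i)%N by exact: leq_addr.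
exists (M j) => w e Lw e0.
(* The corrections add up to at most [e / 2]; the other half of [e] is spent on passing to the
   limit. *)
pose d i := e / 2 / 2 ^+ i.+1.
have d0 i : 0 < d i by rewrite !divr_gt0 // exprn_gt0.
have /boolp.choice [f fP] : forall ix : nat * V, exists y,
    lspan (L (M (j + ix.1)%N)) ix.2 ->
    lspan (L (M (j + ix.1).+1)) y /\ p (j + ix.1)%N (y - ix.2) < d ix.1.
  move=> [i x] /=; have [Lx|nLx] := pselect (lspan (L (M (j + i)%N)) x); last by exists x.
  have Lx' : lspan (L (m (j + i)%N)) x by apply: lspan_sub Lx; exact: L_sub.
  have mm : (m (j + i) <= M (j + i).+1)%N by exact: leq_trans (mM _) (MS _).
  by have [y Ly py] := mP _ _ _ _ mm Lx' (d0 i); exists y.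
pose u := fix u n := if n is n'.+1 then f (n', u n') else w.
have uL i : lspan (L (M (j + i)%N)) (u i).
  elim: i => [|i IH]; first by rewrite addn0.
  by rewrite addnS; exact: (fP (i, u i) IH).1.
have ustep i : p (j + i)%N (u i.+1 - u i) < d i by exact: (fP (i, u i) (uL i)).2.
have udist i n : p (j + i)%N (u (i + n)%N - u i) <= e / 2 / 2 ^+ i * (1 - 2^-1 ^+ n).
  have sp := (cp (j + i)%N).1; elim: n => [|n IH].
    by rewrite addn0 subrr seminorm0 // expr0 subrr mulr0.
  rewrite addnS -(subrKA (u (i + n)%N)); apply: le_trans (seminormD sp _ _) _.
  have h1 : p (j + i)%N (u (i + n).+1 - u (i + n)%N) <= d (i + n)%N.
    apply: le_trans (p_mono _ (_ : (j + i <= j + (i + n))%N)) (ltW (ustep _)).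
    by rewrite leq_add2l leq_addr.
  apply: le_trans (lerD h1 IH) _; rewrite le_eqVlt; apply/orP; left; apply/eqP.
  rewrite /d -addnS exprD !exprVn !exprS; field.
  by rewrite !expf_neq0.
have udist' i k : (i <= k)%N -> p (j + i)%N (u k - u i) <= e / 2 / 2 ^+ i.
  move=> ik; have := udist i (k - i)%N; rewrite subnKC // => h; apply: le_trans h _.
  apply: ler_piMr; first by rewrite !divr_ge0 ?exprn_ge0 // ltW.
  by rewrite gerBl exprn_ge0 // invr_ge0.
have [l ul] : exists l : V, u @ \oo --> l.
  apply: complete => U /p_base[J JU].
  have [k0 ek] : exists k, e / 2 / 2 ^+ k < 2^-1.
    have [k hk] := exprn_unbounded (2 * e) (ltr1n R 2 : 1 < 2%:R :> R).
    exists k; rewrite ltr_pdivrMr ?exprn_gt0 //; lra.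
  pose k := maxn k0 J.
  have ek' : e / 2 / 2 ^+ k < 2^-1.
    apply: le_lt_trans ek; rewrite ler_pM2l ?divr_gt0 // lef_pV2 ?posrE ?exprn_gt0 //.
    by rewrite ler_weXn2l ?ler1n // leq_maxl.
  exists [set u i | i in [set i | (k <= i)%N]].
    by exists k => // i /= ki; exists i.
  move=> _ _ [a /= ka <-] [b /= kb <-]; apply: JU.
  have sp := (cp (j + k)%N).1.
  apply: le_lt_trans (p_mono _ (_ : (J <= j + k)%N)) _.
    by rewrite (leq_trans (leq_maxr k0 J)) // leq_addl.
  rewrite -(subrKA (u k)); apply: le_lt_trans (seminormD sp _ _) _.
  rewrite [p _ (u k - _)]seminorm_distC //.
  have := udist' k a ka; have := udist' k b kb; lra.
exists l => [k|].
  apply/in_closed_span => B /ul [n _ nB].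
  exists (u (maxn n k)); split; last by apply: nB; rewrite /= leq_maxl.
  apply: lspan_sub (uL (maxn n k)); apply: L_sub.
  by apply: leq_trans (iM _); rewrite (leq_trans (leq_maxr n k)) // leq_addl.
have sp := (cp j).1.
have [n _ nB] := iffLR (cvg_seminormP _ _ _) ul _ (cp j) _ (divr_gt0 e0 (ltr0n _ 2)).
have := udist' 0%N n (leq0n _); have /= := nB n (leqnn _).
rewrite addn0 expr0 divr1 /= => h1 h2.
rewrite -(subrKA (u n)); apply: le_lt_trans (seminormD sp _ _) _.
rewrite [p _ (w - _)]seminorm_distC //; lra.
Qed.

End MittagLeffler.

(** * Unipotent radicals *)

Section Representation.
Variables (R : realType) (G : topGroupType) (n : nat) (rho : G -> 'M[R]_n).
Variables (N : topGroupType) (iota : N -> G) (V : tvsType R[i]) (act : N -> V -> V).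
Local Open Scope complex_scope.
Hypothesis rep : matrix_rep rho.
Hypothesis rhoC : continuous rho.
Hypothesis hN : is_unipotent_radical rho iota.

Lemma iota1 : iota 1%g = 1%g.
Proof.
have [_ iM _ _] := hN; have := iM 1%g 1%g; rewrite mulg1.
by move=> /(congr1 (fun x => (iota 1%g)^-1 * x)%g); rewrite mulVg mulKg.
Qed.

Lemma iotaV x : iota (x^-1)%g = ((iota x)^-1)%g.
Proof.
have [_ iM _ _] := hN; have := iM x (x^-1)%g; rewrite mulgV iota1.
by move=> /(congr1 (fun y => (iota x)^-1 * y)%g); rewrite mulg1 mulKg.
Qed.

Lemma iota_continuous : continuous iota.
Proof. by have [_ _ iT _] := hN; move=> x B nB; apply/iT; exists B. Qed.

Lemma rho_iota_unipotent x : unipotent (rho (iota x)).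
Proof. by have [_ _ _ [P _ [[_ _ _ _ h] _]]] := hN; apply: h; exists x. Qed.

Lemma one_param_rho gamma : one_param gamma -> exists X : 'M[R]_n,
  forall i j, little_o_derivative (fun t => rho (iota (gamma t)) i j) 0 (X i j).
Proof.
move=> og; have [_ iM _ _] := hN; have [r1 rM] := rep.
apply: (@one_param_matrix_derivative R n (fun t => rho (iota (gamma t)))).
- move=> i j t.
  apply: (@continuous_comp R 'M[R]_n R (fun t => rho (iota (gamma t))) (fun A => A i j)).
    apply: (@continuous_comp R G _ (fun t => iota (gamma t)) rho); last exact: rhoC.
    apply: (@continuous_comp R N G gamma iota); last exact: iota_continuous.
    by case: og => + _; exact.
  exact: coord_continuous.
- by rewrite one_param0 // iota1.
- by move=> s t; case: og => _ ->; rewrite iM rM.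
Qed.

(** Near the identity the orbit map is [F] applied to the matrix path [A], which is expanded in
    elementary matrices to match the directional chain rule. The resulting [D] does not depend on
    the seminorm, so a limit exists in [V] and [xget] returns one instead of its default 0. *)
Lemma smooth_orbit_differentiable : hausdorff_space V ->
  (forall v, act 1%g v = v) ->
  (forall v, smooth_map (rho \o iota) (act ^~ v)) ->
  forall (gamma : R -> N) v, one_param gamma ->
  (t^-1)%:C *: (act (gamma t) v - v) @[t --> (0 : R)^'] --> lie_act act gamma v.
Proof.
move=> hausV act1 smooth gamma v og.
suff ex : exists D : V, (t^-1)%:C *: (act (gamma t) v - v) @[t --> (0 : R)^'] --> D.
  have h := @xgetPex V 0 [set w | (t^-1)%:C *: (act (gamma t) v - v)
    @[t --> (0 : R)^'] --> w] ex.
  by move: h.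
have [U [F [Uopen U1 CF nF]]] := smooth v 1%g.
have [X hX] := one_param_rho og.
pose A t := rho (iota (gamma t)).
have A0 : A 0 = (rho \o iota) 1%g by rewrite /A one_param0.
have [_ dF] := CF 1%N.
have /boolp.choice [F' F'P] : forall B, exists F',
    (forall A, U A -> has_deriv F A B (F' A)) /\ (forall A, U A -> {for A, continuous F'}).
  by move=> B; have [F' h1 [h2 _]] := dF B; exists F'.
pose l := [seq (delta_mx ij.1 ij.2 : 'M[R]_n, fun t => A t ij.1 ij.2 - A 0 ij.1 ij.2, X ij.1 ij.2)
  | ij <- enum [set: 'I_n * 'I_n]%SET].
pose D := \sum_(x <- l) (x.2)%:C *: F' x.1.1 (A 0).
have UA0 : U (A 0) by rewrite A0.
have sumA t : A 0 + \sum_(x <- l) x.1.2 t *: x.1.1 = A t.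
  rewrite /l big_map big_enum /=.
  transitivity (A 0 + (A t - A 0)); last by rewrite addrC subrK.
  congr (_ + _); rewrite [RHS]matrix_sum_delta pair_big /=.
  apply: eq_big => [ij|ij _]; first by rewrite inE.
  by rewrite [(A t - A 0) _ _]mxE [(- A 0) _ _]mxE.
have key (p : V -> R) : continuous_seminorm p -> sderiv p (fun t => F (A t)) 0 D.
  move=> cp; have := @chain_rule R V n U F (A 0) Uopen UA0 F'.
  have h1 B A' : U A' -> has_deriv F A' B (F' B A') by exact: (F'P B).1.
  have h2 B : {for A 0, continuous (F' B)} by exact: (F'P B).2.
  move=> /(_ h1 h2 p l cp) h.
  have -> : (fun t => F (A t)) = (fun t => F (A 0 + \sum_(x <- l) x.1.2 t *: x.1.1)).
    by apply/funext => t; rewrite sumA.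
  apply: h => _ /mapP[ij _ ->] /=; split; first by rewrite subrr.
  move=> e e0; have := hX ij.1 ij.2 e e0; apply: filterS => t.
  by rewrite add0r -/(A t) -/(A 0) subrr subr0.
exists D.
have := iffRL (cvg_sderiv (fun t => F (A t)) 0 D) key.
have cg : gamma @ (0 : R) --> (1%g : N).
  by rewrite -(one_param0 og); case: og => + _; exact.
have near0 : \forall t \near (0 : R), act (gamma t) v = F (A t).
  exact: (cg _ nF).
have e0 : v = F (A 0).
  by have := nbhs_singleton near0; rewrite one_param0 // act1.
apply: cvg_trans; apply: near_eq_cvg.
rewrite near_withinE; move: near0; apply: filterS => t h _.
by rewrite add0r -h -e0.
Qed.

Variable scale : G -> R.
Hypothesis red : real_reductive rho.
Hypothesis s_gt0 : forall g, 0 < scale g.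
Hypothesis sM : forall g h, scale (g * h)%g <= scale g * scale h.
Hypothesis s_loc : forall g : G, exists C : R, \forall h \near g, scale h <= C.

Definition power_product (k : nat) (l : seq N) : N :=
  foldr (fun u x => u ^+ k * x)%g 1%g l.

Lemma rho_power_product k l : rho (iota (power_product k l)) =
  foldr (fun u M => u ^+ k *m M) 1%:M [seq rho (iota u) | u <- l].
Proof.
have [_ iM _ _] := hN; have [r1 rM] := rep.
elim: l => [|u l IH] /=; first by rewrite iota1.
rewrite iM rM IH; congr (_ *m _).
elim: (k) => [|k' IHk]; first by rewrite expg0 iota1 r1 expr0.
by rewrite expgS iM rM IHk exprS.
Qed.

(** The bound on the scale involves [g^-1] as well; the inverse of a product of [k]-th powers has
    the same shape, so it obeys the same growth estimate. *)
Lemma power_product_inv k l : ((power_product k l)^-1)%g =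
  power_product k (rev [seq (u^-1)%g | u <- l]).
Proof.
have app r1 r2 : power_product k (r1 ++ r2) = (power_product k r1 * power_product k r2)%g.
  elim: r1 => [|u r1 IH] /=; first by rewrite mul1g.
  by rewrite IH mulgA.
elim: l => [|u l IH] /=; first by rewrite invg1.
by rewrite invgM IH rev_cons -cats1 app /= mulg1 expVgn.
Qed.

Lemma power_product_scale : exists E : nat, forall l : seq N, exists2 C, 1 <= C &
  forall k, scale (iota (power_product k l)) <= C * k.+1%:R ^+ E.
Proof.
have [C0 [d [C00 CP]]] := reductive_scale_growth red s_gt0 sM s_loc.
have [_ iM _ _] := hN; have [r1 rM] := rep.
have [||_ [x ->]|E EP] := @unipotent_growth R n [set M | exists x, M = rho (iota x)].
- by exists 1%g; rewrite iota1.
- by move=> _ _ [x ->] [y ->]; exists (x * y)%g; rewrite iM rM.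
- exact: rho_iota_unipotent.
(* [2 * E] because a Gram trace is bounded by the square of a norm growing with exponent [E]; [d] is
   the exponent relating the scale to these traces. *)
exists (2 * E * d)%N => l.
have bnd (r : seq N) : exists2 C, 0 <= C & forall k,
    \tr ((rho (iota (power_product k r)))^T *m rho (iota (power_product k r)))
      <= C * k.+1%:R ^+ (2 * E).
  have [|C C1 h] := EP [seq rho (iota u) | u <- r].
    by move=> _ /mapP[u _ ->]; exists u.
  exists (C ^+ 2) => [|k]; first exact: sqr_ge0.
  apply: le_trans (gram_le_norm1 _) _; rewrite mulnC exprM -exprMn.
  by apply: lerXn2r; rewrite ?nnegrE ?norm1_ge0 ?mulr_ge0 ?exprn_ge0 // rho_power_product.
have [Ca Ca0 Pa] := bnd l; have [Cb Cb0 Pb] := bnd (rev [seq (u^-1)%g | u <- l]).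
(* The leading 1 gives [1 <= C], so that real exponents can later be replaced by larger integral
   ones. *)
exists (1 + C0 * (1 + Ca + Cb) ^+ d) => [|k].
  by rewrite lerDl mulr_ge0 ?exprn_ge0 ?addr_ge0 // ltW.
have k1 : 1 <= (k.+1%:R : R) ^+ (2 * E) by rewrite exprn_ege1 // ler1n.
apply: le_trans (CP _) _.
rewrite -iotaV power_product_inv.
apply: (@le_trans _ _ (C0 * ((1 + Ca + Cb) * k.+1%:R ^+ (2 * E)) ^+ d)).
  rewrite ler_pM2l //; apply: lerXn2r; rewrite ?nnegrE ?mulr_ge0 ?exprn_ge0 ?addr_ge0 ?gram_ge0 //.
  by rewrite !mulrDl mul1r !lerD.
rewrite exprMn -exprM mulrA ler_wpM2r ?exprn_ge0 //.
by rewrite lerDr.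
Qed.

Lemma moderate_growth_power_product : moderate_growth act (scale \o iota) ->
  forall p : V -> R, continuous_seminorm p -> exists E : nat, forall (l : seq N) v,
    exists2 C, 0 <= C & forall k, p (act (power_product k l) v) <= C * k.+1%:R ^+ E.
Proof.
move=> mg p cp; have [r [p2 [r0 cp2 pP]]] := mg p cp.
have [E EP] := power_product_scale.
pose m := (Num.truncn r).+1.
have rm : r <= m%:R by have /andP[_ /ltW] := Num.Theory.truncn_itv r0.
exists (E * m)%N => l v; have [C C1 CP] := EP l.
have C0 : 0 <= C by rewrite (le_trans ler01).
have p20 : 0 <= p2 v by exact: (seminorm_ge0 (proj1 cp2)).
exists (C ^+ m * p2 v) => [|k]; first by rewrite mulr_ge0 // exprn_ge0.
apply: le_trans (pP _ _) _; rewrite mulrAC ler_wpM2r //=.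
have X1 : 1 <= C * k.+1%:R ^+ E.
  by rewrite -[leLHS]mulr1 ler_pM // exprn_ege1 // ler1n.
apply: (@le_trans _ _ ((C * k.+1%:R ^+ E) `^ r)).
  apply: (@ge0_ler_powR R r r0 (scale (iota (power_product k l))) (C * k.+1%:R ^+ E));
    rewrite ?nnegrE ?CP // ltW // (lt_le_trans ltr01) //.
apply: (@le_trans _ _ ((C * k.+1%:R ^+ E) `^ m%:R)); first exact: ler_powR.
by rewrite powR_mulrn ?(le_trans ler01) // exprMn -exprM.
Qed.

End Representation.

Theorem proposition4p3
  (R : realType)
  (G : topGroupType) (n : nat) (rho : G -> 'M[R]_n) (hG : real_reductive rho)
  (scale : G -> R) (hscale : algebraic_scale scale)
  (N : topGroupType) (iota : N -> G) (hN : is_unipotent_radical rho iota)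
  (V : tvsType R[i]) (act : N -> V -> V)
  (hV : smooth_frechet_rep act (rho \o iota) (scale \o iota)) :
  exists q : nat -> quot_tvs (CJ_submodule act) -> R,
    [/\ forall j, seminorm (q j),
        defines_topology q
      & forall j, exists kj : nat, [/\ (0 < kj)%N,
          forall k : nat, (kj < k)%N ->
            forall v, v \in lie_power_closure act k ->
              q j (quot_pi (CJ_submodule act) v) = 0
        & forall k r : nat, (kj < k)%N -> (k < r)%N ->
            forall v, v \in lie_power_closure act k ->
              induced_seminorm (q j) (quot_pi (lie_power_closure act r) v) = 0]].
Proof.
have [_ rep rhoC _ _] := hG; have [s_gt0 sM s_loc _] := hscale.
have [frV [act1 actM actL actC] smooth mg] := hV.
have [hausV _ complete] := frV.
have act_diff := smooth_orbit_differentiable rep rhoC hN hausV act1 smooth.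
have growth := moderate_growth_power_product rep hN hG s_gt0 sM s_loc mg.
have dense (p : V -> R) := @lie_set_dense R N V act hausV act1 actM actL actC act_diff growth p.
have [p [cp p_mono p_base]] := frechet_seminorms frV.
pose W := CJ_submodule act.
have ML j := mittag_leffler cp p_mono p_base complete
  (fun m k mk => @lie_set_sub R N V act m k ^~ mk) (fun j => dense (p j) (cp j)) j.
have closureE k v : (v \in lie_power_closure act k) = (v \in closed_span (lie_set act k)).
  by rewrite /lie_power_closure lie_monomialsE.
have CJP v : (v \in W) <-> forall k, v \in closed_span (lie_set act k).
  split=> [/asboolP h k|h]; first by rewrite -closureE.
  by apply/asboolP => k; rewrite closureE.
have W0 := submodule_set0 W.
have WL := @submodule_set_linear R V W.
pose q j : quot_tvs W -> R := quotient_seminorm (p j).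
have vanish j : exists2 m, (0 < m)%N & forall k v, (m < k)%N ->
    v \in lie_power_closure act k -> q j (quot_pi W v) = 0.
  (* [mittag_leffler] may return 0, whereas [kj] must be positive: hence [m.+1]. *)
  have [m mP] := ML j; exists m.+1 => // k v mk; rewrite closureE.
  have sp := proj1 (cp j); pose d := dist_seminorm (p j) [set w | w \in W].
  have sd : seminorm d by exact: dist_seminormP sp W0 WL.
  have cd : continuous_seminorm d.
    by apply: (dominated_seminorm_continuous (cp j) sd); exact: (dist_le_seminorm sp W0).
  move=> vk; rewrite /q quotient_seminormE; move: v vk.
  (* By continuity of [d] it suffices to treat generators of order [k]; they also have order [m],
     where elements of [W] approximate them for [p j]. *)
  apply: (seminorm_closed_span0 cd) => v Lv.
  apply/eqP; rewrite eq_le (dist_ge0 sp W0) andbT; apply/ler_addgt0Pr => e e0.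
  have Lmv : lspan (lie_set act m) v.
    by apply: lspan_gen; apply: lie_set_sub Lv; rewrite ltnW // ltnW.
  have [l lL lv] := mP v e Lmv e0; rewrite add0r.
  apply: le_trans (ltW lv); apply: (dist_le sp).
  by apply: submodule_setN; apply/CJP.
exists q; split=> [j||j].
- exact: quotient_seminormP (proj1 (cp j)).
- exact: quotient_seminorms_define_topology.
have [m m0 mP] := vanish j; exists m; split=> // [k mk v vk|k r mk kr v vk].
  exact: mP mk vk.
have kr_sub : forall w, w \in lie_power_closure act r -> w \in lie_power_closure act k.
  move=> w; rewrite !closureE; apply: closed_span_sub => x xr; apply: gen_closed_span.
  by apply: lie_set_sub xr; exact: ltnW.
rewrite /induced_seminorm.
(* A representative of the class differs from [v] by an element of order [r > k] and so stays in the
   closure of order [k], where [q j] vanishes: the infimum runs over 0 alone. *)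
have -> : [set q j (quot_pi W w) | w in [set w | quot_pi (lie_power_closure act r) w =
    quot_pi (lie_power_closure act r) v]] = [set 0].
  apply/seteqP; split=> [_ [w /= /quot_piP wv <-]|_ ->]; last first.
    by exists v => //; exact: mP mk vk.
  apply: (mP k) => //; rewrite -[w](subrK v) rpredD //; exact: kr_sub.
exact: inf1.
Qed.
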